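(* Fix finite nonempty sets $A$ and $\Omega$, a prior $\mu_0$ on $\Omega$ with $\mu_0(\omega)>0$ for all $\omega$, and a finite message set $M$ with $|M|>\max\{|\Omega|,|A|\}$. There is a set of environments of Lebesgue measure one in $[0,1]^{2|A||\Omega|}$ such that, for every environment in this set, the following three statements are equivalent: (i) commitment is valuable; (ii) committed Sender values randomization; (iii) for every optimal persuasion profile $(\sigma,\rho)$ there exists $m\in M_\sigma$ such that $\left|\arg\max_{a\in A}\sum_\omega \mu_m(\omega)u_R(a,\omega)\right|\ge 2$, where $\mu_m(\omega)=\frac{\mu_0(\omega)\sigma(m|\omega)}{\sum_{\omega'}\mu_0(\omega')\sigma(m|\omega')}$.
   Context: An environment is a pair $(u_S,u_R)$ of functions $A\times\Omega\to[0,1]$, identified with a point of $[0,1]^{2|A||\Omega|}$. A messaging strategy is $\sigma:\Omega\to\Delta M$ and an action strategy is $\rho:M\to\Delta A$. For $i\in\{S,R\}$, $U_i(\sigma,\rho)=\sum_{\omega,m,a}\mu_0(\omega)\sigma(m|\omega)\rho(a|m)u_i(a,\omega)$. A profile $(\sigma,\rho)$ is S-BR if $\sigma\in\arg\max_{\sigma'}U_S(\sigma',\rho)$, and R-BR if $\rho\in\arg\max_{\rho'}U_R(\sigma,\rho')$. A persuasion profile is an R-BR profile; the persuasion payoff is the maximum of $U_S$ over persuasion profiles; a persuasion profile attaining it is optimal. A cheap-talk equilibrium is an S-BR and R-BR profile; the cheap-talk payoff is the maximum of $U_S$ over cheap-talk equilibria. Commitment is valuable if the persuasion payoff strictly exceeds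 the cheap-talk payoff. $\sigma$ is partitional if for every $\omega$ some $m$ has $\sigma(m|\omega)=1$. The partitional persuasion payoff is the maximum of $U_S$ over persuasion profiles with partitional $\sigma$. Committed Sender values randomization if the persuasion payoff strictly exceeds the partitional persuasion payoff. $M_\sigma=\{m\in M:\sigma(m|\omega)>0\text{ for some }\omega\}$. *)

(* Defs.v *)
From HB Require Import structures.
From mathcomp Require Import all_boot all_order all_algebra.
From mathcomp Require Import reals.
Set Implicit Arguments. Unset Strict Implicit. Unset Printing Implicit Defensive.
Import Order.TTheory GRing.Theory Num.Theory.
Local Open Scope ring_scope.

Section Game.
Variables (R : realType) (A Om M : finType).

Definition is_distr (T : finType) (p : T -> R) :=
  (forall t, 0 <= p t) /\ \sum_(t : T) p t = 1.

(* environment (u_S, u_R), each a function A x Omega -> R *)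
Definition env := ((A -> Om -> R) * (A -> Om -> R))%type.

Definition in_cube (e : env) :=
  forall a w, (0 <= e.1 a w <= 1) /\ (0 <= e.2 a w <= 1).

(* messaging strategy sigma w m = sigma(m|w); action strategy rho m a = rho(a|m) *)
Definition msg_strat (sigma : Om -> M -> R) := forall w, is_distr (sigma w).
Definition act_strat (rho : M -> A -> R) := forall m, is_distr (rho m).

Definition payoff (mu0 : Om -> R) (u : A -> Om -> R)
    (sigma : Om -> M -> R) (rho : M -> A -> R) : R :=
  \sum_(w : Om) \sum_(m : M) \sum_(a : A) mu0 w * sigma w m * rho m a * u a w.

Definition S_BR mu0 (e : env) sigma rho :=
  forall sigma', msg_strat sigma' -> payoff mu0 e.1 sigma' rho <= payoff mu0 e.1 sigma rho.
Definition R_BR mu0 (e : env) sigma rho :=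
  forall rho', act_strat rho' -> payoff mu0 e.2 sigma rho' <= payoff mu0 e.2 sigma rho.

Definition persuasion_profile mu0 e sigma rho :=
  [/\ msg_strat sigma, act_strat rho & R_BR mu0 e sigma rho].
Definition cheap_talk_eq mu0 e sigma rho :=
  [/\ msg_strat sigma, act_strat rho, S_BR mu0 e sigma rho & R_BR mu0 e sigma rho].

Definition partitional (sigma : Om -> M -> R) := forall w, exists m, sigma w m = 1.

(* the maxima of the paper, written as suprema (they are attained) *)
Definition persuasion_payoff mu0 (e : env) : R :=
  sup (fun v : R => exists sigma rho, persuasion_profile mu0 e sigma rho /\
                                 v = payoff mu0 e.1 sigma rho).
Definition cheap_talk_payoff mu0 (e : env) : R :=
  sup (fun v : R => exists sigma rho, cheap_talk_eq mu0 e sigma rho /\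
                                 v = payoff mu0 e.1 sigma rho).
Definition partitional_persuasion_payoff mu0 (e : env) : R :=
  sup (fun v : R => exists sigma rho, persuasion_profile mu0 e sigma rho /\
                                 partitional sigma /\ v = payoff mu0 e.1 sigma rho).

Definition optimal_persuasion mu0 e sigma rho :=
  persuasion_profile mu0 e sigma rho /\
  payoff mu0 e.1 sigma rho = persuasion_payoff mu0 e.

Definition commitment_valuable mu0 e :=
  cheap_talk_payoff mu0 e < persuasion_payoff mu0 e.
Definition values_randomization mu0 e :=
  partitional_persuasion_payoff mu0 e < persuasion_payoff mu0 e.

Definition Msupp (sigma : Om -> M -> R) : {set M} :=
  [set m | [exists w, 0 < sigma w m]].

Definition posterior (mu0 : Om -> R) (sigma : Om -> M -> R) (m : M) (w : Om) : R :=
  mu0 w * sigma w m / \sum_(w' : Om) mu0 w' * sigma w' m.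

Definition receiver_argmax mu0 (e : env) sigma (m : M) : {set A} :=
  [set a | [forall b, \sum_(w : Om) posterior mu0 sigma m w * e.2 b w
                      <= \sum_(w : Om) posterior mu0 sigma m w * e.2 a w]].

Definition indifference_at_optimum mu0 e :=
  forall sigma rho, optimal_persuasion mu0 e sigma rho ->
    exists2 m, m \in Msupp sigma & (2 <= #|receiver_argmax mu0 e sigma m|)%N.

Definition in_box (lo hi : env) (e : env) :=
  forall a w, (lo.1 a w <= e.1 a w <= hi.1 a w) /\ (lo.2 a w <= e.2 a w <= hi.2 a w).
Definition box_vol (lo hi : env) : R :=
  (\prod_(a : A) \prod_(w : Om) (hi.1 a w - lo.1 a w)) *
  (\prod_(a : A) \prod_(w : Om) (hi.2 a w - lo.2 a w)).
Definition lebesgue_null (N : env -> Prop) :=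
  forall eps : R, 0 < eps -> exists lo hi : nat -> env,
    [/\ forall k a w, (lo k).1 a w <= (hi k).1 a w /\ (lo k).2 a w <= (hi k).2 a w,
        forall e, N e -> exists k, in_box (lo k) (hi k) e
      & forall n, \sum_(k < n) box_vol (lo k) (hi k) <= eps].
End Game.

(* Main.v *)
Require Import Defs.
From HB Require Import structures.
From mathcomp Require Import all_boot all_order all_algebra.
From mathcomp Require Import boolp classical_sets reals.
From mathcomp Require Import topology normedtype derive.
From mathcomp Require Import ring lra.
Set Implicit Arguments.
Unset Strict Implicit.
Unset Printing Implicit Defensive.
Import Order.TTheory GRing.Theory Num.Theory.
Import numFieldTopology.Exports numFieldNormedType.Exports.
Local Open Scope ring_scope.

(* Persuasion is a linear program over outcomes z(a, w), the joint distributions of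
   action and state that the Receiver is willing to obey.  For almost every environment
   (1) the Sender is never indifferent between two actions in a state, (2) the Receiver
   is never indifferent between two actions at a belief obtained by conditioning the
   prior on a set of states, and (3) the linear program has a unique solution: two
   solutions force a square bordered minor, which is affine in one coordinate of u_S
   with nonzero slope, to vanish, and such a set is a countable union of Lipschitz
   graphs.

   (i) => (iii): if every message of an optimal profile has a unique best response,
   obedience is strict, so a profitable deviation of the Sender, performed with small
   probability, would improve on the optimum; hence the optimum is a cheap-talk outcome.
   (iii) => (ii): an optimal partitional profile has unique best responses by (2).
   (ii) => (i): in an optimal cheap-talk equilibrium the Receiver does not mix, since
   moving mass between two actions played at a message would give a second solution;
   by (1) each state then leads to a single action, which makes the outcome
   partitional. *)

(** * Null sets: countable unions and Lipschitz graphs *)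

Section NullSets.
Variables (R : realType) (A Om : finType).
Local Notation env := (env R A Om).
Local Notation coord := ((bool * A) * Om)%type.

(* The Boolean component of a coordinate selects u_S (true) or u_R (false). *)
Definition crd (e : env) (i : coord) : R :=
  if i.1.1 then e.1 i.1.2 i.2 else e.2 i.1.2 i.2.

Definition mk_env (x : coord -> R) : env :=
  (fun a w => x (true, a, w), fun a w => x (false, a, w)).

Lemma crd_mk x i : crd (mk_env x) i = x i.
Proof. by case: i => [[[] a] w]. Qed.

Lemma in_cubeP (e : env) : in_cube e <-> forall i, 0 <= crd e i <= 1.
Proof.
split=> [h [[[] a] w]|h a w]; first by case: (h a w).
  by case: (h a w).
by split; [exact: (h (true, a, w))|exact: (h (false, a, w))].
Qed.

Lemma in_boxP (lo hi e : env) :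
  in_box lo hi e <-> forall i, crd lo i <= crd e i <= crd hi i.
Proof.
split=> [h [[[] a] w]|h a w]; first by case: (h a w).
  by case: (h a w).
by split; [exact: (h (true, a, w))|exact: (h (false, a, w))].
Qed.

Lemma box_volE (lo hi : env) : box_vol lo hi = \prod_i (crd hi i - crd lo i).
Proof.
rewrite /box_vol !pair_bigA /=.
rewrite (eq_bigr (fun p : A * Om => crd hi (true, p.1, p.2) - crd lo (true, p.1, p.2))) //.
rewrite [X in _ * X](eq_bigr
  (fun p : A * Om => crd hi (false, p.1, p.2) - crd lo (false, p.1, p.2))) //.
transitivity (\prod_(b : bool) \prod_(p : A * Om)
   (crd hi (b, p.1, p.2) - crd lo (b, p.1, p.2))).
  by rewrite big_bool.
rewrite pair_bigA /= (reindex (fun i : coord => (i.1.1, (i.1.2, i.2)))) /=.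
  by apply: eq_bigr => -[[b a] w].
by exists (fun x => (x.1, x.2.1, x.2.2)) => [[[]]|[? []]].
Qed.

Lemma box_vol_ge0 (lo hi : env) : (forall i, crd lo i <= crd hi i) -> 0 <= box_vol lo hi.
Proof. by move=> h; rewrite box_volE prodr_ge0 // => i _; rewrite subr_ge0. Qed.

Lemma box_vol_point (i0 : coord) (e : env) : box_vol e e = 0.
Proof. by rewrite box_volE (bigD1 i0) //= subrr mul0r. Qed.

Lemma sum_subset_seq (K : eqType) (F : K -> R) (s t : seq K) :
  uniq s -> {subset s <= t} -> (forall k, 0 <= F k) ->
  \sum_(k <- s) F k <= \sum_(k <- t) F k.
Proof.
move=> us st F0.
have usub : {subset s <= undup t} by move=> x; rewrite mem_undup; apply: st.
have -> : \sum_(k <- s) F k = \sum_(k <- undup t | k \in s) F k.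
  rewrite -[RHS]big_filter; apply: perm_big; apply: uniq_perm => //.
    by rewrite filter_uniq // undup_uniq.
  by move=> x; rewrite mem_filter; case xs : (x \in s) => //=; rewrite usub.
apply: (@le_trans _ _ (\sum_(k <- undup t) F k)).
  by rewrite [leRHS](bigID (mem s)) /= lerDl sumr_ge0.
elim: t {st usub} => //= x t IH.
case: ifP => _; rewrite !big_cons; first by rewrite (le_trans IH) // lerDr.
by rewrite lerD2l.
Qed.

(** Boxes indexed by a countable type are laid out along [pickle], and idle indices receive a
    degenerate box. The coordinate [i0] makes its volume 0, since an empty product would be 1. *)
Lemma null_of_countable_cover (i0 : coord) (N : env -> Prop) :
  (forall eps : R, 0 < eps -> exists (K : countType) (lo hi : K -> env),
    [/\ forall k i, crd (lo k) i <= crd (hi k) i,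
        forall e, N e -> exists k, in_box (lo k) (hi k) e
      & forall s : seq K, uniq s -> \sum_(k <- s) box_vol (lo k) (hi k) <= eps]) ->
  lebesgue_null N.
Proof.
move=> h eps eps0; have [K [lo [hi [lh cov vol]]]] := h _ eps0.
pose z := mk_env (fun=> 0).
pose ext (f : K -> env) n := if pickle_inv n is Some k then f k else z.
exists (ext lo), (ext hi); split.
- move=> n a w; rewrite /ext; case: pickle_inv => [k|] //=.
  by split; [exact: (lh k (true, a, w))|exact: (lh k (false, a, w))].
- by move=> e /cov[k ek]; exists (pickle k); rewrite /ext pickleK_inv.
- move=> n.
  have -> : \sum_(k < n) box_vol (ext lo k) (ext hi k) =
    \sum_(k <- pmap (@pickle_inv K) (iota 0 n)) box_vol (lo k) (hi k).
    rewrite -(big_mkord xpredT (fun k => box_vol (ext lo k) (ext hi k))).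
    rewrite /index_iota subn0; elim: (iota 0 n) => [|m s IH]; first by rewrite !big_nil.
    rewrite big_cons /= IH {1 2}/ext; case: pickle_inv => [k|] /=.
      by rewrite big_cons.
    by rewrite (box_vol_point i0) add0r.
  apply: vol.
  apply: (@pmap_uniq _ _ (@pickle_inv K) (@pickle K)); last exact: iota_uniq.
  by move=> m; apply: pickle_invK.
Qed.

Lemma null_sub (N N' : env -> Prop) :
  (forall e, N e -> N' e) -> lebesgue_null N' -> lebesgue_null N.
Proof.
move=> sub h eps /h[lo [hi [lh cov vol]]]; exists lo, hi; split=> // e /sub.
exact: cov.
Qed.

Lemma geometric_sum_le (n : nat) : \sum_(k < n) (2^-1 : R) ^+ k.+1 <= 1.
Proof.
suff -> : \sum_(k < n) (2^-1 : R) ^+ k.+1 = 1 - 2^-1 ^+ n.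
  by rewrite gerBl exprn_ge0 // invr_ge0.
elim: n => [|n IH]; first by rewrite big_ord0 expr0 subrr.
by rewrite big_ord_recr /= IH exprS; lra.
Qed.

Lemma null_bigcup_nat (i0 : coord) (N : nat -> env -> Prop) :
  (forall n, lebesgue_null (N n)) -> lebesgue_null (fun e => exists n, N n e).
Proof.
move=> hN; apply: (null_of_countable_cover i0) => eps eps0.
exists (nat * nat)%type.
have h n : exists lh : (nat -> env) * (nat -> env),
   [/\ forall k i, crd (lh.1 k) i <= crd (lh.2 k) i,
       forall e, N n e -> exists k, in_box (lh.1 k) (lh.2 k) e
     & forall m, \sum_(k < m) box_vol (lh.1 k) (lh.2 k) <= eps * 2^-1 ^+ n.+1].
  have e0 : 0 < eps * 2^-1 ^+ n.+1 by rewrite mulr_gt0 // exprn_gt0 // invr_gt0.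
  have [lo [hi [l1 l2 l3]]] := hN n _ e0.
  by exists (lo, hi); split=> //= k [[[] a] w]; case: (l1 k a w).
have {}[f hf] := choice h.
exists (fun p => (f p.1).1 p.2), (fun p => (f p.1).2 p.2); split.
- by move=> [n k] i; case: (hf n).
- by move=> e [n]; case: (hf n) => _ cov _ /cov[k ek]; exists (n, k).
move=> s us.
(* [m] exceeds every index occurring in [s], so [s] lies in the square [t], whose row [n] costs at
   most eps / 2^(n+1). *)
pose m := (\max_(p <- s) maxn p.1 p.2).+1.
pose t := [seq (n, k) | n <- iota 0 m, k <- iota 0 m].
apply: (@le_trans _ _ (\sum_(p <- t) box_vol ((f p.1).1 p.2) ((f p.1).2 p.2))).
  apply: sum_subset_seq => // [[n k] nks|[n k]]; last first.
    by apply: box_vol_ge0 => i; case: (hf n).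
  have : (maxn n k < m)%N.
    by rewrite ltnS (@leq_bigmax_seq _ s xpredT (fun p => maxn p.1 p.2) (n, k)).
  rewrite gtn_max => /andP[nm km].
  by apply/allpairsP; exists (n, k); rewrite !mem_iota /=.
rewrite /t big_allpairs /=.
apply: (@le_trans _ _ (\sum_(n <- iota 0 m) eps * 2^-1 ^+ n.+1)).
  apply: ler_sum => n _; case: (hf n) => _ _ /(_ m); congr (_ <= _).
  by rewrite -(big_mkord xpredT (fun k => box_vol ((f n).1 k) ((f n).2 k))) /index_iota subn0.
rewrite -big_distrr /= ger_pMr //; have := geometric_sum_le m.
by rewrite -(big_mkord xpredT (fun k => (2^-1 : R) ^+ k.+1)) /index_iota subn0.
Qed.

Lemma null_bigcup (K : countType) (i0 : coord) (N : K -> env -> Prop) :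
  (forall k, lebesgue_null (N k)) -> lebesgue_null (fun e => exists k, N k e).
Proof.
move=> hN; pose N' n e := if pickle_inv n is Some k then N k e else False.
apply: (@null_sub _ (fun e => exists n, N' n e)).
  by move=> e [k ke]; exists (pickle k); rewrite /N' pickleK_inv.
apply: null_bigcup_nat => // n; rewrite /N'; case: pickle_inv => // eps eps0.
exists (fun=> mk_env (fun=> 0)), (fun=> mk_env (fun=> 0)); split=> // n'.
by rewrite big1 ?ltW // => k _; rewrite (box_vol_point i0).
Qed.

Lemma grid_cell (k : nat) (x : R) : 0 <= x <= 1 ->
  exists c : 'I_k.+1, c%:R / k.+1%:R <= x <= c.+1%:R / k.+1%:R.
Proof.
move=> /andP[x0 x1].
suff h n : (n <= k)%N -> x <= n.+1%:R / k.+1%:R ->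
    exists c : 'I_k.+1, c%:R / k.+1%:R <= x <= c.+1%:R / k.+1%:R.
  by apply: (h k) => //; rewrite divff // pnatr_eq0.
elim: n => [|n IH] nk xn; first by exists ord0; rewrite mul0r x0 xn.
have [/(IH (ltnW nk))//|] := leP x (n.+1%:R / k.+1%:R) => /ltW nx.
by exists (inord n.+1); rewrite inordK ?ltnS // nx xn.
Qed.

(** Over each grid cell of side 1/(k+1) in the coordinates other than [j], the points of [N] have
    [j]-coordinates within L/(k+1) of a common centre. The boxes of height 2L/(k+1) over these cells
    have total volume 2L/(k+1). *)
Lemma null_lipschitz_graph (j : coord) (N : env -> Prop) (L : R) : 0 <= L ->
  (forall e, N e -> in_cube e) ->
  (forall e e' d, N e -> N e' -> 0 <= d -> (forall i, i != j -> `|crd e i - crd e' i| <= d) ->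
     `|crd e j - crd e' j| <= L * d) ->
  lebesgue_null N.
Proof.
move=> L0 Nc Nl.
pose K k := {ffun coord -> 'I_k.+1}.
suff H k : exists lo hi : K k -> env,
  [/\ forall c i, crd (lo c) i <= crd (hi c) i,
      forall e, N e -> exists c, in_box (lo c) (hi c) e
    & \sum_c box_vol (lo c) (hi c) <= 2 * L / k.+1%:R].
  apply: (null_of_countable_cover j) => eps eps0.
  have [k Hk] : exists k, 2 * L / k.+1%:R <= eps.
    exists (Num.truncn (2 * L / eps)).
    by rewrite ler_pdivrMr ?ltr0n // [leRHS]mulrC -ler_pdivrMr // ltW // truncnS_gt.
  have [lo [hi [lh cov vol]]] := H k.
  exists (K k), lo, hi; split=> // s us; apply: le_trans Hk; apply: le_trans vol.
  rewrite -[leRHS]big_enum /=; apply: sum_subset_seq => // [x|c].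
    by rewrite mem_enum.
  exact: box_vol_ge0.
have k0 : 0 < k.+1%:R :> R by rewrite ltr0n.
pose cell (c : K k) e := forall i, i != j ->
  (c i)%:R / k.+1%:R <= crd e i <= (c i).+1%:R / k.+1%:R.
have hctr (c : K k) : exists x, forall e, N e -> cell c e -> `|crd e j - x| <= L / k.+1%:R.
  have [[e0 [Ne0 ce0]]|no] := pselect (exists e, N e /\ cell c e); last first.
    by exists 0 => e Ne ce; case: no; exists e.
  exists (crd e0 j) => e Ne ce; apply: Nl => // [|i ij]; first by rewrite invr_ge0 ltW.
  have /andP[a1 a2] := ce _ ij; have /andP[b1 b2] := ce0 _ ij.
  rewrite ler_norml; move: a1 a2 b1 b2; rewrite -[(c i).+1%:R]natr1 mulrDl div1r.
  set u := _ / _; set v := _^-1; move=> *; apply/andP; split; lra.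
have {hctr}[ctr hctr] := choice hctr.
(* A code [c] also has a value at [j], so each cell has k+1 codes; only the one with [c j == ord0]
   gets a thick box, and the others have volume 0. *)
pose rad (c : K k) := if c j == ord0 then L / k.+1%:R else 0.
have rad0 c : 0 <= rad c by rewrite /rad; case: ifP => // _; rewrite divr_ge0 // ltW.
exists (fun c => mk_env (fun i => if i == j then ctr c - rad c else (c i)%:R / k.+1%:R)),
  (fun c => mk_env (fun i => if i == j then ctr c + rad c else (c i).+1%:R / k.+1%:R)).
split.
- move=> c i; rewrite !crd_mk; case: ifP => _.
    by have := rad0 c; lra.
  by rewrite ler_pM2r ?invr_gt0 // ler_nat.
- move=> e Ne.
  have /choice[c hc] : forall i, exists c : 'I_k.+1,
      if i == j then c = ord0 else c%:R / k.+1%:R <= crd e i <= c.+1%:R / k.+1%:R.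
    move=> i; case: (i == j); first by exists ord0.
    by apply: grid_cell; have /in_cubeP := Nc _ Ne; apply.
  exists [ffun i => c i]; apply/in_boxP => i; rewrite !crd_mk; have := hc i.
  have [-> cj|ij] := eqVneq i j; last by rewrite ffunE.
  have := @hctr [ffun i => c i] e Ne; rewrite /rad ffunE cj eqxx ler_norml.
  case/(_ _)/andP => [i' i'j|]; last first.
    by rewrite /=; set u := _ / _; move=> *; apply/andP; split; lra.
  by have := hc i'; rewrite (negbTE i'j) ffunE.
(* Volume is a product over coordinates, so the sum over codes is a product of sums: 2L/(k+1) from
   [j] and 1 from every other coordinate. *)
- pose F i (c : 'I_k.+1) : R := if i == j then (if c == ord0 then 2 * L / k.+1%:R else 0)
                            else k.+1%:R^-1.
  rewrite (eq_bigr (fun c : K k => \prod_i F i (c i))).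
    rewrite -(bigA_distr_bigA F) (bigD1 j) //= [X in _ * X]big1 ?mulr1 => [|i ij].
      by rewrite /F eqxx -big_mkcond /= big_pred1_eq.
    by rewrite /F (negbTE ij) sumr_const card_ord -[LHS]mulr_natl mulfV ?pnatr_eq0.
  move=> c _; rewrite box_volE; apply: eq_bigr => i _; rewrite !crd_mk /F.
  have [->|ij] := eqVneq i j.
    by rewrite /rad; case: ifP => _; ring.
  by rewrite -[(c i).+1%:R]natr1; ring.
Qed.

(** * Zero sets of Lipschitz functions that are affine in one coordinate *)

Definition upd (e : env) (j : coord) (t : R) : env :=
  mk_env (fun i => if i == j then t else crd e i).

Lemma crd_upd e j t i : crd (upd e j t) i = if i == j then t else crd e i.
Proof. exact: crd_mk. Qed.

(** One constant serves both as a bound and as a Lipschitz constant for the sup norm; the bound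
    makes the class closed under products, hence under determinants. *)
Definition cube_lipschitz (q : env -> R) := exists2 L : R, 0 <= L &
  (forall e, in_cube e -> `|q e| <= L) /\
  (forall e e' d, in_cube e -> in_cube e' -> 0 <= d -> (forall i, `|crd e i - crd e' i| <= d) ->
     `|q e - q e'| <= L * d).

Lemma cube_lipschitz_cst (c : R) : cube_lipschitz (fun=> c).
Proof.
exists `|c| => //; split=> // e e' d _ _ d0 _.
by rewrite subrr normr0 mulr_ge0.
Qed.

Lemma cube_lipschitz_add (q r : env -> R) :
  cube_lipschitz q -> cube_lipschitz r -> cube_lipschitz (fun e => q e + r e).
Proof.
move=> [K K0 [bq lq]] [L L0 [br lr]]; exists (K + L); first exact: addr_ge0.
split=> [e ce|e e' d ce ce' d0 h].
  by rewrite (le_trans (ler_normD _ _)) // lerD ?bq ?br.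
rewrite opprD addrACA (le_trans (ler_normD _ _)) // mulrDl lerD ?lq ?lr //.
Qed.

Lemma cube_lipschitz_mul (q r : env -> R) :
  cube_lipschitz q -> cube_lipschitz r -> cube_lipschitz (fun e => q e * r e).
Proof.
move=> [K K0 [bq lq]] [L L0 [br lr]]; exists (K * L *+ 2).
  by rewrite mulrn_wge0 // mulr_ge0.
split=> [e ce|e e' d ce ce' d0 h].
  rewrite normrM mulr2n; apply: (@le_trans _ _ (K * L)).
    by rewrite ler_pM ?bq ?br.
  by rewrite lerDl mulr_ge0.
have -> : q e * r e - q e' * r e' = q e * (r e - r e') + (q e - q e') * r e' by ring.
rewrite (le_trans (ler_normD _ _)) // !normrM.
have -> : K * L *+ 2 * d = K * (L * d) + (K * d) * L by ring.
by rewrite lerD // ler_pM // ?bq ?br ?lq ?lr.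
Qed.

Lemma cube_lipschitz_crd (i : coord) : cube_lipschitz (fun e => crd e i).
Proof.
exists 1 => //; split=> [e /in_cubeP/(_ i)/andP[c0 c1]|e e' d _ _ _ h].
  by rewrite ger0_norm.
by rewrite mul1r.
Qed.

Lemma cube_lipschitz_sum (J : Type) (s : seq J) (P : pred J) (F : J -> env -> R) :
  (forall k, cube_lipschitz (F k)) -> cube_lipschitz (fun e => \sum_(k <- s | P k) F k e).
Proof.
move=> h; elim: s => [|k s IH].
  under eq_fun do rewrite big_nil; exact: cube_lipschitz_cst.
under eq_fun do rewrite big_cons; case: (P k) => //; exact: cube_lipschitz_add.
Qed.

Lemma cube_lipschitz_prod (J : Type) (s : seq J) (F : J -> env -> R) :
  (forall k, cube_lipschitz (F k)) -> cube_lipschitz (fun e => \prod_(k <- s) F k e).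
Proof.
move=> h; elim: s => [|k s IH].
  under eq_fun do rewrite big_nil; exact: cube_lipschitz_cst.
under eq_fun do rewrite big_cons; exact: cube_lipschitz_mul.
Qed.

Lemma cube_lipschitz_det n (F : env -> 'M[R]_n) :
  (forall i k, cube_lipschitz (fun e => F e i k)) -> cube_lipschitz (fun e => \det (F e)).
Proof.
move=> h; apply: cube_lipschitz_sum => s; apply: cube_lipschitz_mul.
  exact: cube_lipschitz_cst.
exact: cube_lipschitz_prod.
Qed.

(** On the piece where |D e| >= 1/(n+1), take two zeros e and e' of [q] within d of each other off
    [j]. Giving e the [j]-coordinate of e' changes [q] by |D e| times the gap, and the new value is
    at most L d in size because q e' = 0. So each piece is a Lipschitz graph with constant (n+1)L,
    and countably many pieces cover the set. *)
Lemma null_affine_zero (j : coord) (q D : env -> R) :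
  cube_lipschitz q ->
  (forall e t, q (upd e j t) - q e = D e * (t - crd e j)) ->
  lebesgue_null (fun e => [/\ in_cube e, q e = 0 & D e != 0]).
Proof.
move=> [L L0 [_ lq]] hq.
apply: (@null_sub _ (fun e => exists n : nat,
   [/\ in_cube e, q e = 0 & n.+1%:R^-1 <= `|D e|])).
  move=> e [ce qe De]; exists (Num.truncn `|D e|^-1); split=> //.
  by rewrite -[leRHS]invrK lef_pV2 ?posrE ?invr_gt0 ?normr_gt0 ?ltr0n // ltW // truncnS_gt.
apply: (null_bigcup_nat j) => n.
apply: (@null_lipschitz_graph j _ (n.+1%:R * L)) => [|e []//|e e' d].
  by rewrite mulr_ge0.
move=> [ce qe De] [ce' qe' _] d0 h.
have := hq e (crd e' j); rewrite qe subr0 => hu.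
have cu : in_cube (upd e j (crd e' j)).
  apply/in_cubeP => i; rewrite crd_upd; case: eqP => _; first by have /in_cubeP := ce'; apply.
  by have /in_cubeP := ce; apply.
have : `|q (upd e j (crd e' j)) - q e'| <= L * d.
  apply: lq => // i; rewrite crd_upd; case: eqVneq => [->|ij]; first by rewrite subrr normr0.
  exact: h.
rewrite qe' subr0 hu normrM => hL.
rewrite -mulrA -ler_pdivrMl ?ltr0n // distrC; apply: le_trans hL.
by rewrite ler_wpM2r.
Qed.
End NullSets.

(** * Bordered minors of a matrix with a nontrivial kernel *)

Section BorderedMinors.
Variable F : fieldType.

Lemma det_zero_row n (B : 'M[F]_n) i : (forall k, B i k = 0) -> \det B = 0.
Proof. by move=> B0; rewrite (expand_det_row _ i) big1 // => k _; rewrite B0 mul0r. Qed.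

Lemma det_zero_col n (B : 'M[F]_n) k : (forall i, B i k = 0) -> \det B = 0.
Proof. by move=> B0; rewrite (expand_det_col _ k) big1 // => i _; rewrite B0 mul0r. Qed.

(** The determinant is linear in the last row, and the two last rows differ by (t - s)(0, 1). With
    last row (0, 1) the matrix is block triangular of determinant [\det B]. *)
Lemma det_block_corner n (B : 'M[F]_n) (u : 'cV_n) (v : 'rV_n) (s t : F) :
  \det (block_mx B u v t%:M) - \det (block_mx B u v s%:M) = \det B * (t - s).
Proof.
rewrite (@determinant_multilinear _ _ _ (block_mx B u v s%:M) (block_mx B u 0 1%:M)
  (rshift n ord0) 1 (t - s)).
- by rewrite det_ublock det1; ring.
- by rewrite block_mxEv rowKd row_id block_mxEv rowKd row_id block_mxEv rowKd row_id;
     apply/rowP => k; rewrite !mxE; case: split => k'; rewrite !mxE ?ord1 ?eqxx; ring.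
- by rewrite !block_mxEv !row'Kd; congr (castmx _ (col_mx _ _)); apply/matrixP => -[].
- by rewrite !block_mxEv !row'Kd; congr (castmx _ (col_mx _ _)); apply/matrixP => -[].
Qed.

(** As [c] vanishes on the kernel of [H], it is a combination [v] of the [\rank H] independent rows
    picked by [f], and (v, -1) annihilates the bordered matrix. A column [j] in the support of [d0]
    and outside [g] exists: otherwise the invertible minor would kill the restriction of [d0] to
    [g], forcing [d0] = 0. *)
Lemma bordered_minor_mx p n (H : 'M[F]_(p, n)) (c : 'rV_n) (d0 : 'cV_n) :
  H *m d0 = 0 -> d0 != 0 -> (forall d : 'cV_n, H *m d = 0 -> c *m d = 0) ->
  exists r (f : 'I_r -> 'I_p) (g : 'I_r -> 'I_n) (j : 'I_n),
  [/\ d0 j 0 != 0, forall k, g k != j, \det (mxsub f g H) != 0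
    & \det (block_mx (mxsub f g H) (\col_k H (f k) j) (\row_k c 0 (g k)) (c 0 j)%:M) = 0].
Proof.
move=> Hd d0N0 Hc.
pose f := maxrankfun H; pose B := rowsub f H.
have Bfree : row_free B by apply: maxrowsub_free.
have BTfull : row_full B^T by move: Bfree; rewrite /row_free /row_full mxrank_tr.
pose g := fullrankfun BTfull.
have Bu : mxsub f g H \in unitmx.
  have := fullrowsub_unit BTfull; rewrite -unitmx_tr.
  suff -> : (rowsub g B^T)^T = mxsub f g H by [].
  by apply/matrixP => i k; rewrite !mxE.
(* The columns of [cokermx H] lie in the kernel of [H], and a row vector that annihilates all of
   them lies in the row space of [H]. *)
have cB : (c <= B)%MS.
  rewrite eq_maxrowsub submxE; apply/eqP/matrixP => i k.
  have Hk : H *m col k (cokermx H) = 0 by rewrite colE mulmxA mulmx_coker mul0mx.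
  have := Hc _ Hk; rewrite colE mulmxA -colE => /matrixP/(_ i 0).
  by rewrite mxE => ->; rewrite !mxE.
have /submxP[v cE] := cB.
have [j d0j jg] : exists2 j, d0 j 0 != 0 & forall k, g k != j.
  have [//|no] := pselect (exists2 j, d0 j 0 != 0 & forall k, g k != j).
  case/eqP: d0N0.
  have gout j : (forall k, g k != j) -> d0 j 0 = 0.
    by move=> h; apply/eqP/negP => /negP d0j; apply: no; exists j.
  have gin : (\col_k d0 (g k) 0) = 0 :> 'cV_(\rank H).
    have : mxsub f g H *m (\col_k d0 (g k) 0) = 0.
      apply/colP => i; rewrite !mxE.
      have /colP/(_ (f i)) := Hd; rewrite !mxE => hfi; rewrite -[RHS]hfi.
      rewrite [RHS](bigID (fun j => j \in codom g)) /= [X in _ + X]big1 ?addr0.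
        rewrite -[RHS]big_filter [RHS](perm_big (codom g)) /=; last first.
          apply: uniq_perm.
          - by rewrite filter_uniq // index_enum_uniq.
          - by rewrite map_inj_uniq ?enum_uniq //; exact: fullrankfun_inj.
          - by move=> x; rewrite mem_filter mem_index_enum andbT.
        rewrite big_map big_enum; apply: eq_big => [k|k _]; first by rewrite inE.
        by rewrite !mxE.
      move=> j jg; rewrite gout ?mulr0 // => k.
      by apply: contraNneq jg => <-; rewrite codom_f.
    by move/(congr1 (mulmx (invmx (mxsub f g H)))); rewrite mulKmx // mulmx0.
  apply/colP => j; rewrite !mxE.
  have [/codomP[k ->]|jg] := boolP (j \in codom g).
    by have /colP/(_ k) := gin; rewrite !mxE.
  by apply: gout => k; apply: contraNneq jg => <-; rewrite codom_f.
exists (\rank H), f, g, j; split=> //.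
  by rewrite -unitfE -unitmxE.
apply/eqP/det0P; exists (row_mx v (-1)%:M).
  apply/eqP => /(congr1 rsubmx) /matrixP/(_ 0 0)/eqP; rewrite row_mxKr !mxE eqxx mulr1n.
  by rewrite oppr_eq0 oner_eq0.
rewrite mul_row_block -[RHS]row_mx0; congr row_mx.
  apply/rowP => k; rewrite cE mul_scalar_mx !mxE mulN1r.
  by under [X in X - _]eq_bigr do rewrite !mxE; under [X in _ - X]eq_bigr do rewrite !mxE;
   rewrite subrr.
rewrite mul_scalar_mx; apply/matrixP => a b; rewrite !ord1 !mxE eqxx mulr1n mulN1r cE !mxE.
by under [X in X - _]eq_bigr do rewrite !mxE; under [X in _ - X]eq_bigr do rewrite !mxE;
   rewrite subrr.
Qed.

Lemma bordered_minor (Row Col : finType) (h : Row -> Col -> F) (c d0 : Col -> F) :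
  (forall i, \sum_k h i k * d0 k = 0) -> (exists k, d0 k != 0) ->
  (forall d, (forall i, \sum_k h i k * d k = 0) -> \sum_k c k * d k = 0) ->
  exists r (f : 'I_r -> Row) (g : 'I_r -> Col) (j : Col),
  [/\ d0 j != 0, forall k, g k != j, \det (\matrix_(i, k) h (f i) (g k)) != 0
    & \det (block_mx (\matrix_(i, k) h (f i) (g k)) (\col_i h (f i) j)
                     (\row_k c (g k)) (c j)%:M) = 0].
Proof.
move=> hd [k0 d0k0] hc.
pose H := \matrix_(i < #|Row|, k < #|Col|) h (enum_val i) (enum_val k).
pose C := \row_(k < #|Col|) c (enum_val k).
pose D0 := \col_(k < #|Col|) d0 (enum_val k).
have sumE (G : Col -> F) : \sum_(k < #|Col|) G (enum_val k) = \sum_k G k.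
  by rewrite [RHS](reindex (@enum_val _ (mem Col))) //; apply/onW_bij/enum_val_bij.
have [||d Hd|r [f [g [j [dj gj m0 b0]]]]] := @bordered_minor_mx _ _ H C D0.
- apply/colP => i; rewrite !mxE -[RHS](hd (enum_val i)) -sumE.
  by apply: eq_bigr => k _; rewrite !mxE.
- apply/eqP => /colP/(_ (enum_rank k0))/eqP; rewrite !mxE enum_rankK.
  by apply/negP.
- apply/rowP => i; rewrite ord1 !mxE -[RHS](hc (fun k => d (enum_rank k) 0)) => [|i'].
    by rewrite -sumE; apply: eq_bigr => k _; rewrite !mxE enum_valK.
  have /colP/(_ (enum_rank i')) := Hd; rewrite !mxE -sumE => hi; rewrite -[RHS]hi.
  by apply: eq_bigr => k _; rewrite !mxE enum_valK enum_rankK.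
exists r, (fun k => enum_val (f k)), (fun k => enum_val (g k)), (enum_val j); split.
- by move: dj; rewrite mxE.
- by move=> k; rewrite (inj_eq enum_val_inj).
- by move: m0; congr (\det _ != 0); apply/matrixP => i k; rewrite !mxE.
- rewrite -[RHS]b0; congr (\det (block_mx _ _ _ _)).
  + by apply/matrixP => i k; rewrite !mxE.
  + by apply/matrixP => i k; rewrite !mxE.
  + by apply/matrixP => i k; rewrite !mxE.
  + by rewrite mxE.
Qed.

End BorderedMinors.

(** * The persuasion linear program over outcomes *)

Section Outcomes.
Variables (R : realType) (A Om : finType) (mu0 : Om -> R).
Local Notation env := (env R A Om).
Implicit Types (u z d : A -> Om -> R) (e : env).

Definition value u z : R := \sum_a \sum_w z a w * u a w.

Definition obedience u z a b : R := \sum_w z a w * (u a w - u b w).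

(* The outcomes of persuasion profiles: z a w is the probability that the state is w
   and the Receiver takes action a, and obedience says that the Receiver is willing to
   follow the recommendation a. *)
Definition outcome e z :=
  [/\ forall a w, 0 <= z a w, forall w, \sum_a z a w = mu0 w
    & forall a b, 0 <= obedience e.2 z a b].

Definition optimal_outcome e z :=
  outcome e z /\ forall z', outcome e z' -> value e.1 z' <= value e.1 z.

Lemma valueDZ u z d t : value u (fun a w => z a w + t * d a w) = value u z + t * value u d.
Proof.
rewrite /value mulr_sumr -big_split /=; apply: eq_bigr => a _.
by rewrite mulr_sumr -big_split /=; apply: eq_bigr => w _; ring.
Qed.

Lemma obedienceDZ u z d t a b :
  obedience u (fun a w => z a w + t * d a w) a b = obedience u z a b + t * obedience u d a b.
Proof. by rewrite /obedience mulr_sumr -big_split /=; apply: eq_bigr => w _; ring. Qed.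

Lemma small_step (T : finType) (x d : T -> R) :
  (forall t, 0 <= x t) -> (forall t, x t = 0 -> 0 <= d t) ->
  exists2 eps, 0 < eps & forall t, 0 <= x t + eps * d t.
Proof.
(* Division by 0 yields 0, so indices with [x t = 0] add nothing to [S]. Elsewhere |d t| <= S x t,
   which makes any step up to 1/S safe; the added 1 guards against [S = 0]. *)
move=> x0 dx; pose S := \sum_t `|d t| / x t.
have S0 t : 0 <= `|d t| / x t by rewrite divr_ge0.
have Sge : 0 <= S by apply: sumr_ge0.
exists (1 + S)^-1; first by rewrite invr_gt0; lra.
move=> t; have [xt|xt] := eqVneq (x t) 0.
  by rewrite xt add0r mulr_ge0 ?dx // invr_ge0; lra.
have xp : 0 < x t by rewrite lt_neqAle eq_sym xt x0.
have dS : `|d t| <= (1 + S) * x t.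
  rewrite -ler_pdivrMr //; apply: (@le_trans _ _ S); last lra.
  by rewrite /S (bigD1 t) //= lerDl sumr_ge0.
have : - x t <= (1 + S)^-1 * d t.
  rewrite -ler_pdivrMl ?invr_gt0 ?invrK; last lra.
  by move: dS; rewrite ler_norml mulrN => /andP[].
lra.
Qed.

Lemma optimal_direction e z d : optimal_outcome e z ->
  (forall w, \sum_a d a w = 0) -> (forall a w, z a w = 0 -> 0 <= d a w) ->
  (forall a b, obedience e.2 z a b = 0 -> 0 <= obedience e.2 d a b) ->
  value e.1 d <= 0.
Proof.
move=> [[z0 zs zo] zopt] ds dz dob.
pose x (t : (A * Om) + (A * A)) :=
  match t with inl p => z p.1 p.2 | inr p => obedience e.2 z p.1 p.2 end.
pose y (t : (A * Om) + (A * A)) :=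
  match t with inl p => d p.1 p.2 | inr p => obedience e.2 d p.1 p.2 end.
have [||eps eps0 h] := @small_step _ x y.
- by case=> -[? ?] /=.
- by case=> -[? ?] /=; auto.
have : outcome e (fun a w => z a w + eps * d a w).
  split=> [a w|w|a b]; first exact: (h (inl (a, w))).
    by rewrite big_split /= zs -mulr_sumr ds mulr0 addr0.
  by rewrite obedienceDZ; exact: (h (inr (a, b))).
by move=> /zopt; rewrite valueDZ gerDl pmulr_rle0.
Qed.

(** The constraint matrix of the linear program: Bayes plausibility rows ([inl]) and obedience rows
    ([inr]). It is applied to u_R only, so u_S enters a bordered minor through the border alone. *)
Definition constraint_coef u (i : Om + A * A) (k : A * Om) : R :=
  match i with
  | inl w => (w == k.2)%:R
  | inr p => (p.1 == k.1)%:R * (u p.1 k.2 - u p.2 k.2)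
  end.

Lemma sum_delta (T : finType) (t : T) (G : T -> R) : \sum_s (t == s)%:R * G s = G t.
Proof.
rewrite (bigD1 t) //= eqxx mul1r big1 ?addr0 // => s st.
by rewrite eq_sym (negbTE st) mul0r.
Qed.

Lemma constraint_coefE u d i : \sum_k constraint_coef u i k * d k.1 k.2 =
  match i with inl w => \sum_a d a w | inr p => obedience u d p.1 p.2 end.
Proof.
case: i => [w|[a b]] /=.
  rewrite -(pair_bigA _ (fun a w' => (w == w')%:R * d a w')) /=.
  by apply: eq_bigr => a _; rewrite sum_delta.
rewrite -(pair_bigA _ (fun a' w' => (a == a')%:R * (u a w' - u b w') * d a' w')) /=.
under eq_bigr do (under eq_bigr do rewrite -mulrA; rewrite -mulr_sumr).
by rewrite sum_delta; apply: eq_bigr => w _; rewrite mulrC.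
Qed.

Definition minor_mx u r (f : 'I_r -> Om + A * A) (g : 'I_r -> A * Om) : 'M[R]_r :=
  \matrix_(i, k) constraint_coef u (f i) (g k).

Definition bordered_mx e r (f : 'I_r -> Om + A * A) (g : 'I_r -> A * Om) (j : A * Om) :=
  block_mx (minor_mx e.2 f g) (\col_i constraint_coef e.2 (f i) j)
           (\row_k e.1 (g k).1 (g k).2) (e.1 j.1 j.2)%:M.

(* At the midpoint of two optima, feasible directions are two-sided on the support and
   on the binding constraints, so u_S is orthogonal to a nonzero kernel, that is, it
   lies in the row space of a singular submatrix. *)
Lemma two_optima_bordered_minor e z z' : optimal_outcome e z -> optimal_outcome e z' ->
  (exists a w, z a w != z' a w) ->
  exists r (f : 'I_r -> Om + A * A) (g : 'I_r -> A * Om) (j : A * Om),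
  [/\ forall k, g k != j, \det (minor_mx e.2 f g) != 0 & \det (bordered_mx e f g j) = 0].
Proof.
move=> oz oz' [a0 [w0 zz']].
have [[z0 zs zo] zopt] := oz; have [[z0' zs' zo'] zopt'] := oz'.
pose x a w := 2^-1 * z a w + 2^-1 * z' a w.
have obx a b : obedience e.2 x a b = 2^-1 * obedience e.2 z a b + 2^-1 * obedience e.2 z' a b.
  by rewrite /obedience !mulr_sumr -big_split /=; apply: eq_bigr => w _; rewrite /x; ring.
have valx : value e.1 x = 2^-1 * value e.1 z + 2^-1 * value e.1 z'.
  rewrite /value !mulr_sumr -big_split /=; apply: eq_bigr => a _.
  by rewrite !mulr_sumr -big_split /=; apply: eq_bigr => w _; rewrite /x; ring.
have ox : optimal_outcome e x.
  split=> [|z'' oz'']; last by rewrite valx; have := zopt _ oz''; have := zopt' _ oz''; lra.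
  split=> [a w|w|a b]; first by have := z0 a w; have := z0' a w; rewrite /x; lra.
    by rewrite big_split /= -!mulr_sumr zs zs'; lra.
  by rewrite obx; have := zo a b; have := zo' a b; lra.
pose tight (i : Om + A * A) := if i is inr p then obedience e.2 x p.1 p.2 == 0 else true.
pose supp (k : A * Om) := x k.1 k.2 != 0.
(* Slack rows and columns off the support are set to 0 instead of being removed, which keeps the
   index types. *)
pose h i k := if tight i && supp k then constraint_coef e.2 i k else 0.
pose c k := if supp k then e.1 k.1 k.2 else 0.
have hE i d : (forall a w, x a w = 0 -> d a w = 0) ->
    tight i -> \sum_k h i k * d k.1 k.2 =
    match i with inl w => \sum_a d a w | inr p => obedience e.2 d p.1 p.2 end.
  move=> dx ti; rewrite -constraint_coefE; apply: eq_bigr => k _.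
  by rewrite /h ti /supp; have [/dx->|//] := eqVneq (x k.1 k.2) 0; rewrite !mulr0.
have hE' i (d : A * Om -> R) : ~~ tight i -> \sum_k h i k * d k = 0.
  by move=> ti; rewrite big1 // => k _; rewrite /h (negbTE ti) mul0r.
pose d0 a w := z a w - z' a w.
have d0x a w : x a w = 0 -> d0 a w = 0.
  by have := z0 a w; have := z0' a w; rewrite /x /d0; lra.
have obd0 a b : obedience e.2 d0 a b = obedience e.2 z a b - obedience e.2 z' a b.
  by rewrite /obedience -sumrB; apply: eq_bigr => w _; rewrite /d0; ring.
have [|||r [f [g [j [dj gj m0 b0]]]]] := @bordered_minor _ _ _ h c (fun k => d0 k.1 k.2).
- move=> i; have [ti|/hE'//] := boolP (tight i).
  rewrite hE //; case: i ti => [w _|[a b] /= /eqP].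
    by rewrite sumrB zs zs' subrr.
  by rewrite obx obd0; have := zo a b; have := zo' a b; lra.
- by exists (a0, w0); rewrite subr_eq0.
- move=> y hy.
  (* [y] is unconstrained off the support, where [h] and [c] vanish. Clearing it there yields a
     direction feasible with both signs. *)
  pose D a w := if supp (a, w) then y (a, w) else 0.
  have Dx a w : x a w = 0 -> D a w = 0 by rewrite /D /supp /= => ->; rewrite eqxx.
  have hD i : \sum_k h i k * D k.1 k.2 = 0.
    rewrite -[RHS](hy i); apply: eq_bigr => -[a w] _; rewrite /h /D /=.
    by case: (supp (a, w)); rewrite ?andbT // andbF !mul0r.
  have Ds w : \sum_a D a w = 0 by rewrite -[RHS](hD (inl w)) hE.
  have Do a b : obedience e.2 x a b = 0 -> obedience e.2 D a b = 0.
    by move=> xab; rewrite -[RHS](hD (inr (a, b))) hE //= xab.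
  have -> : \sum_k c k * y k = value e.1 D.
    rewrite /value pair_bigA /=; apply: eq_bigr => -[a w] _; rewrite /c /D /=.
    by case: (supp (a, w)); [rewrite mulrC|rewrite !mul0r].
  apply/eqP; rewrite eq_le; apply/andP; split.
    by apply: (optimal_direction ox) => // [a w /Dx->|a b /Do->].
  have : value e.1 (fun a w => 0 + (-1) * D a w) <= 0.
    apply: (optimal_direction ox) => [w|a w /Dx->|a b /Do xab].
    + by rewrite big_split /= -mulr_sumr Ds big1 //; lra.
    + lra.
    + by rewrite (obedienceDZ _ (fun _ _ => 0)) xab /obedience big1 ?mulr0 ?addr0 // => w _;
         rewrite mul0r.
  rewrite (valueDZ _ (fun _ _ => 0)) {1}/value big1; first lra.
  by move=> a _; rewrite big1 // => w _; rewrite mul0r.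
(* A nonzero minor has no zero row or column, so it uses tight rows and supported columns only,
   where [h] agrees with [constraint_coef]. *)
have tf i : tight (f i).
  apply: contraNT m0 => ti; apply/eqP/(@det_zero_row _ _ _ i) => k.
  by rewrite mxE /h (negbTE ti).
have sg k : supp (g k).
  apply: contraNT m0 => sk; apply/eqP/(@det_zero_col _ _ _ k) => i.
  by rewrite mxE /h (negbTE sk) andbF.
have sj : supp j by apply: contraNneq dj => /d0x->.
exists r, f, g, j; split=> //.
  move: m0; congr (\det _ != 0); apply/matrixP => i k.
  by rewrite !mxE /h tf sg.
rewrite -[RHS]b0; congr (\det (block_mx _ _ _ _)).
+ by apply/matrixP => i k; rewrite !mxE /h tf sg.
+ by apply/matrixP => i k; rewrite !mxE /h tf sj.
+ by apply/matrixP => i k; rewrite !mxE /c sg.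
+ by rewrite /c sj.
Qed.

End Outcomes.

(** * Almost every environment is regular *)

Section Genericity.
Variables (R : realType) (A Om : finType) (mu0 : Om -> R).
Hypothesis mu0_gt0 : forall w, 0 < mu0 w.
Local Notation env := (env R A Om).

Lemma crdS (e : env) a w : e.1 a w = crd e (true, a, w). Proof. by []. Qed.
Lemma crdR (e : env) a w : e.2 a w = crd e (false, a, w). Proof. by []. Qed.

Lemma cube_lipschitz_S a w : cube_lipschitz (fun e : env => e.1 a w).
Proof. by have := @cube_lipschitz_crd R A Om (true, a, w). Qed.

Lemma cube_lipschitz_R a w : cube_lipschitz (fun e : env => e.2 a w).
Proof. by have := @cube_lipschitz_crd R A Om (false, a, w). Qed.

Lemma cube_lipschitz_opp (q : env -> R) :
  cube_lipschitz q -> cube_lipschitz (fun e => - q e).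
Proof.
move=> lq; under eq_fun do rewrite -mulN1r.
by apply: cube_lipschitz_mul => //; apply: cube_lipschitz_cst.
Qed.

Lemma cube_lipschitz_coef i k : cube_lipschitz (fun e : env => constraint_coef e.2 i k).
Proof.
case: i => [w|p] /=; first exact: cube_lipschitz_cst.
apply: cube_lipschitz_mul; first exact: cube_lipschitz_cst.
apply: cube_lipschitz_add; first exact: cube_lipschitz_R.
by apply: cube_lipschitz_opp; exact: cube_lipschitz_R.
Qed.

(** Since [j] is not among the columns [g], the coordinate of u_S at [j] occurs in the corner only;
    the bordered determinant is affine in it, with the minor as slope. *)
Lemma null_bordered r (f : 'I_r -> Om + A * A) (g : 'I_r -> A * Om) (j : A * Om) :
  (forall k, g k != j) ->
  lebesgue_null (fun e : env =>
    [/\ in_cube e, \det (bordered_mx e f g j) = 0 & \det (minor_mx e.2 f g) != 0]).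
Proof.
move=> gj; apply: (@null_affine_zero _ _ _ (true, j.1, j.2)).
  apply: cube_lipschitz_det => i k.
  have [i' ->|i' ->] := split_ordP i; have [k' ->|k' ->] := split_ordP k.
  - under eq_fun do rewrite block_mxEul mxE; exact: cube_lipschitz_coef.
  - under eq_fun do rewrite block_mxEur mxE; exact: cube_lipschitz_coef.
  - under eq_fun do rewrite block_mxEdl mxE; exact: cube_lipschitz_S.
  - under eq_fun do rewrite block_mxEdr mxE; rewrite !ord1 eqxx; exact: cube_lipschitz_S.
move=> e t; rewrite /bordered_mx.
have -> : (upd e (true, j.1, j.2) t).2 = e.2.
  by apply/funext => a; apply/funext => w; rewrite crdR crd_upd.
have -> : \row_k (upd e (true, j.1, j.2) t).1 (g k).1 (g k).2 = \row_k e.1 (g k).1 (g k).2.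
  apply/rowP => k; rewrite !mxE !crdS crd_upd; case: eqP => // -[g1 g2].
  by case/negP: (gj k); apply/eqP; rewrite [g k]surjective_pairing g1 g2 -surjective_pairing.
by rewrite det_block_corner crdS crd_upd eqxx.
Qed.

Definition regular (e : env) :=
  [/\ forall a b w, a != b -> e.1 a w != e.1 b w,
      forall (W : {set Om}) a b, W != finset.set0 -> a != b ->
        \sum_(w in W) mu0 w * (e.2 a w - e.2 b w) != 0
    & forall z z', optimal_outcome mu0 e z -> optimal_outcome mu0 e z' ->
        forall a w, z a w = z' a w].

Lemma null_sender_tie a b w : a != b ->
  lebesgue_null (fun e : env => in_cube e /\ e.1 a w = e.1 b w).
Proof.
move=> ab; apply: null_sub (@null_affine_zero _ _ _ (true, a, w)
  (fun e => e.1 a w - e.1 b w) (fun=> 1) _ _).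
- by move=> e [ce ->]; rewrite subrr oner_neq0.
- apply: cube_lipschitz_add; first exact: cube_lipschitz_S.
  by apply: cube_lipschitz_opp; exact: cube_lipschitz_S.
- move=> e t; rewrite !crdS !crd_upd eqxx !xpair_eqE eqxx eq_sym (negbTE ab) /=; ring.
Qed.

Lemma null_receiver_tie (W : {set Om}) a b : W != finset.set0 -> a != b ->
  lebesgue_null (fun e : env =>
    in_cube e /\ \sum_(w in W) mu0 w * (e.2 a w - e.2 b w) = 0).
Proof.
move=> /finset.set0Pn[w0 wW] ab; apply: null_sub (@null_affine_zero _ _ _ (false, a, w0)
  (fun e => \sum_(w in W) mu0 w * (e.2 a w - e.2 b w)) (fun=> mu0 w0) _ _).
- by move=> e [ce ->]; rewrite gt_eqF.
- apply: cube_lipschitz_sum => w; apply: cube_lipschitz_mul; first exact: cube_lipschitz_cst.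
  apply: cube_lipschitz_add; first exact: cube_lipschitz_R.
  by apply: cube_lipschitz_opp; exact: cube_lipschitz_R.
- move=> e t; rewrite -sumrB (bigD1 w0) // [X in _ + X = _]big1 => [|w /andP[_ ww]].
    by rewrite !crdR !crd_upd eqxx !xpair_eqE eqxx eq_sym (negbTE ab) /=; ring.
  by rewrite !crdR !crd_upd !xpair_eqE (negbTE ww) !andbF subrr.
Qed.

Lemma null_not_regular (a0 : A) (w0 : Om) :
  lebesgue_null (fun e : env => in_cube e /\ ~ regular e).
Proof.
have i0 := (true, a0, w0).
pose K1 := (A * A * Om)%type; pose K2 := ({set Om} * A * A)%type.
(* All sizes and all choices of rows, columns and border column form one index type; coding the
   choices as finite functions makes it countable. *)
pose K3 := {r : nat & ({ffun 'I_r -> Om + A * A} * {ffun 'I_r -> A * Om} * (A * Om))%type}.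
pose N1 (k : K1) (e : env) := k.1.1 != k.1.2 /\ (in_cube e /\ e.1 k.1.1 k.2 = e.1 k.1.2 k.2).
pose N2 (k : K2) (e : env) := (k.1.1 != finset.set0 /\ k.1.2 != k.2) /\ (in_cube e /\
  \sum_(w in k.1.1) mu0 w * (e.2 k.1.2 w - e.2 k.2 w) = 0).
pose N3 (k : K3) (e : env) := (forall i, (tagged k).1.2 i != (tagged k).2) /\
  [/\ in_cube e, \det (bordered_mx e (tagged k).1.1 (tagged k).1.2 (tagged k).2) = 0
    & \det (minor_mx e.2 (tagged k).1.1 (tagged k).1.2) != 0].
(* Side conditions on the index are part of the sets, so that whole types can serve as indices.
   Where such a condition fails the set is empty, a union over [void]. *)
have null_and (P : Prop) (N : env -> Prop) :
    (P -> lebesgue_null N) -> lebesgue_null (fun e => P /\ N e).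
  move=> h; have [/h|nP] := pselect P; first by apply: null_sub => e [].
  apply: (null_sub _ (@null_bigcup _ _ _ void i0 (fun _ _ => False) _)).
    by move=> e [].
  by case.
pose N (k : K1 + (K2 + K3)) :=
  match k with inl k => N1 k | inr (inl k) => N2 k | inr (inr k) => N3 k end.
apply: (@null_sub _ _ _ _ (fun e => exists k, N k e)); last first.
  apply: (null_bigcup i0) => -[k|[k|k]]; apply: null_and.
  - exact: null_sender_tie.
  - by case=> *; apply: null_receiver_tie.
  - exact: null_bordered.
move=> e [ce nreg]; have [//|noN] := pselect (exists k, N k e).
case: nreg; split=> [a b w ab|W a b W0 ab|z z' oz oz' a w].
- by apply/eqP => eab; apply: noN; exists (inl (a, b, w)).
- by apply/eqP => eab; apply: noN; exists (inr (inl (W, a, b))).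
apply/eqP/negP => /negP zz'; apply: noN.
have [|r [f [g [j [gj m0 b0]]]]] := two_optima_bordered_minor oz oz'; first by exists a, w.
pose k : K3 := existT _ r (finfun f, finfun g, j).
exists (inr (inr k)); split=> /=.
  by move=> i; rewrite ffunE.
have -> : finfun f = f :> (_ -> _) by apply/funext => i; rewrite ffunE.
by have -> : finfun g = g :> (_ -> _) by apply/funext => i; rewrite ffunE.
Qed.

End Genericity.

(** * Best responses for linear payoffs on products of simplices *)

Section BestResponses.
Variables (R : realType) (I K : finType).
Implicit Types (p Y : I -> K -> R).

(** The elementary deviation: in row [i], the whole mass at [k] goes to [l]. *)
Definition shift p i k l : I -> K -> R :=
  fun j m => p j m + (i == j)%:R * (p i k * ((l == m)%:R - (k == m)%:R)).

Lemma distr_gt0 (q : K -> R) : is_distr q -> exists k, 0 < q k.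
Proof.
move=> [q0 q1]; have [/existsP//|/existsPn no] := boolP [exists k, 0 < q k].
have : \sum_k q k = 0.
  by apply: big1 => k _; apply/eqP; rewrite eq_le q0 andbT leNgt no.
by rewrite q1 => /eqP; rewrite oner_eq0.
Qed.

Lemma shift_distr p i k l : (forall j, is_distr (p j)) -> forall j, is_distr (shift p i k l j).
Proof.
move=> hp j; split=> [m|].
  rewrite /shift; have [<-|_] := eqVneq i j; last by rewrite mul0r addr0; case: (hp j).
  have [+ _] := hp i => p0; have := p0 m; have := p0 k.
  by have [<-|_] := eqVneq k m; have [_|_] := eqVneq l _; rewrite ?mulr1n ?mulr0n; lra.
rewrite big_split /= -!mulr_sumr sumrB.
have h t : \sum_(m : K) (t == m)%:R = 1 :> R.
  by rewrite -[RHS](@sum_delta R K t (fun=> 1)); apply: eq_bigr => m _; rewrite mulr1.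
by rewrite !h subrr !mulr0 addr0; case: (hp j).
Qed.

Lemma shift_sum p Y i k l : \sum_j \sum_m shift p i k l j m * Y j m =
  \sum_j \sum_m p j m * Y j m + p i k * (Y i l - Y i k).
Proof.
rewrite /shift.
under eq_bigr do (under eq_bigr do rewrite mulrDl; rewrite big_split /=).
rewrite big_split /=; congr (_ + _).
rewrite -[RHS](@sum_delta R I i (fun j => p i k * (Y j l - Y j k))).
apply: eq_bigr => j _.
rewrite -[Y j l](@sum_delta R K l (Y j)) -[Y j k](@sum_delta R K k (Y j)) -sumrB !mulr_sumr.
by apply: eq_bigr => m _; ring.
Qed.

(** A linear payoff is maximised row by row, and [shift] tests a single row. Both players are
    covered: rows are messages for the Receiver ([payoff_msg]) and states for the Sender
    ([payoff_state]). *)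
Lemma best_responseP p Y : (forall i, is_distr (p i)) ->
  (forall p', (forall i, is_distr (p' i)) ->
     \sum_i \sum_k p' i k * Y i k <= \sum_i \sum_k p i k * Y i k) <->
  (forall i k l, 0 < p i k -> Y i l <= Y i k).
Proof.
move=> hp; split=> [h i k l pk|h p' hp'].
  by have := h _ (@shift_distr p i k l hp); rewrite shift_sum gerDl pmulr_rle0 // subr_le0.
apply: ler_sum => i _; have [k pk] := distr_gt0 (hp i).
have [p0 p1] := hp i; have [p0' p1'] := hp' i.
apply: (@le_trans _ _ (Y i k)).
  rewrite -[leRHS]mul1r -p1' mulr_suml; apply: ler_sum => l _.
  by rewrite ler_wpM2l // h.
rewrite -[leLHS]mul1r -p1 mulr_suml; apply: ler_sum => l _.
have [->|pl] := eqVneq (p i l) 0; first by rewrite !mul0r.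
by rewrite ler_wpM2l // h // lt_neqAle eq_sym pl p0.
Qed.

End BestResponses.

(** * Strategy profiles and the outcomes they induce *)

Section Game.
Variables (R : realType) (A Om M : finType) (mu0 : Om -> R).
Hypothesis mu0_gt0 : forall w, 0 < mu0 w.
Hypothesis mu0_sum : \sum_w mu0 w = 1.
Implicit Types (u z : A -> Om -> R) (e : env R A Om).
Implicit Types (sigma : Om -> M -> R) (rho : M -> A -> R).

(* Unnormalised: the expectation on the event that the message m is sent. *)
Definition msg_value u sigma m a : R := \sum_w mu0 w * sigma w m * u a w.

Definition outcome_of sigma rho (a : A) (w : Om) : R :=
  \sum_m mu0 w * sigma w m * rho m a.

Lemma payoff_msg u sigma rho :
  payoff mu0 u sigma rho = \sum_m \sum_a rho m a * msg_value u sigma m a.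
Proof.
rewrite /payoff exchange_big /=; apply: eq_bigr => m _.
rewrite exchange_big /=; apply: eq_bigr => a _.
by rewrite /msg_value mulr_sumr; apply: eq_bigr => w _; ring.
Qed.

Lemma payoff_state u sigma rho :
  payoff mu0 u sigma rho = \sum_w \sum_m sigma w m * (mu0 w * \sum_a rho m a * u a w).
Proof.
rewrite /payoff; apply: eq_bigr => w _; apply: eq_bigr => m _.
by rewrite !mulr_sumr; apply: eq_bigr => a _; ring.
Qed.

Lemma payoff_outcome u sigma rho :
  payoff mu0 u sigma rho = value u (outcome_of sigma rho).
Proof.
rewrite /payoff /value /outcome_of [RHS]exchange_big /=; apply: eq_bigr => w _.
rewrite exchange_big /=; apply: eq_bigr => a _.
by rewrite mulr_suml.
Qed.

Lemma R_BRP e sigma rho : act_strat rho -> R_BR mu0 e sigma rho <->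
  (forall m a b, 0 < rho m a -> msg_value e.2 sigma m b <= msg_value e.2 sigma m a).
Proof.
move=> hr; rewrite -(best_responseP _ hr) /R_BR.
by split=> h rho' /h; rewrite !payoff_msg.
Qed.

Lemma S_BRP e sigma rho : msg_strat sigma -> S_BR mu0 e sigma rho <->
  (forall w m m', 0 < sigma w m ->
     \sum_a rho m' a * e.1 a w <= \sum_a rho m a * e.1 a w).
Proof.
move=> hs; transitivity (forall w m m', 0 < sigma w m ->
     mu0 w * \sum_a rho m' a * e.1 a w <= mu0 w * \sum_a rho m a * e.1 a w).
  rewrite -(best_responseP (fun w m => mu0 w * \sum_a rho m a * e.1 a w) hs) /S_BR.
  by split=> h sigma' /h; rewrite !payoff_state.
by split=> h w m m' /(h w m m'); rewrite ler_pM2l.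
Qed.

Lemma obedience_outcome_of u sigma rho a b : obedience u (outcome_of sigma rho) a b =
  \sum_m rho m a * (msg_value u sigma m a - msg_value u sigma m b).
Proof.
rewrite /obedience /outcome_of; under eq_bigr do rewrite mulr_suml.
rewrite exchange_big /=; apply: eq_bigr => m _.
by rewrite /msg_value -sumrB mulr_sumr; apply: eq_bigr => w _; ring.
Qed.

(** The obedience slack of [a] is a sum over messages; a message contributes only if [a] is played
    after it, and then [a] is a best response there. *)
Lemma outcome_of_outcome e sigma rho :
  persuasion_profile mu0 e sigma rho -> outcome mu0 e (outcome_of sigma rho).
Proof.
move=> [hs hr /(R_BRP _ _ hr) br]; split=> [a w|w|a b].
- apply: sumr_ge0 => m _; have [s0 _] := hs w; have [r0 _] := hr m.
  by rewrite !mulr_ge0 // ltW.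
- rewrite /outcome_of exchange_big /=.
  under eq_bigr => m _ do rewrite -mulr_sumr (hr m).2 mulr1.
  by rewrite -mulr_sumr (hs w).2 mulr1.
rewrite obedience_outcome_of sumr_ge0 // => m _; have [r0 _] := hr m.
have [->|ra] := eqVneq (rho m a) 0; first by rewrite mul0r.
by rewrite mulr_ge0 // subr_ge0 br // lt_neqAle eq_sym ra r0.
Qed.

Lemma sum_fibers (T U : finType) (f : T -> U) (G : T -> R) :
  \sum_y \sum_(x | f x == y) G x = \sum_x G x.
Proof. by rewrite [RHS](partition_big f xpredT). Qed.

Definition used z (a : A) := [exists w, z a w != 0].

(** Direct recommendations: [iota a] is the message that recommends [a], to be decoded by a map
    [phi]. Decoding is asked of used actions only, which makes [iota] injective on those. *)
Definition direct_msg (iota : A -> M) z : Om -> M -> R :=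
  fun w m => \sum_(a | iota a == m) z a w / mu0 w.

Definition direct_act (phi : M -> A) : M -> A -> R := fun m a => (phi m == a)%:R.

Section Direct.
Variables (e : env R A Om) (z : A -> Om -> R) (iota : A -> M) (phi : M -> A).
Hypothesis oz : outcome mu0 e z.
Hypothesis phiK : forall a, used z a -> phi (iota a) = a.

Lemma direct_msg_strat : msg_strat (direct_msg iota z).
Proof.
have [z0 zs _] := oz; move=> w; split=> [m|].
  by apply: sumr_ge0 => a _; rewrite divr_ge0 // ltW.
rewrite /direct_msg sum_fibers -mulr_suml zs.
by rewrite divff // gt_eqF.
Qed.

Lemma direct_act_strat : act_strat (direct_act phi).
Proof.
move=> m; split=> [a|]; first by rewrite /direct_act ler0n.
rewrite -[RHS](@sum_delta R A (phi m) (fun=> 1)).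
by apply: eq_bigr => a _; rewrite mulr1.
Qed.

Lemma direct_msg_gt0 w m : 0 < direct_msg iota z w m ->
  exists a, [/\ iota a = m, z a w != 0 & phi m = a].
Proof.
move=> sm; have [/existsP[a /andP[/eqP am za]]|/existsPn no] :=
  boolP [exists a, (iota a == m) && (z a w != 0)].
  by exists a; split=> //; rewrite -am phiK //; apply/existsP; exists w.
move: sm; rewrite /direct_msg big1 ?ltxx // => a am.
by have := no a; rewrite am /= negbK => /eqP ->; rewrite mul0r.
Qed.

Lemma direct_outcome a w : outcome_of (direct_msg iota z) (direct_act phi) a w = z a w.
Proof.
rewrite /outcome_of /direct_msg /direct_act.
transitivity (\sum_m \sum_(b | iota b == m) (a == b)%:R * z b w).
  apply: eq_bigr => m _; rewrite mulr_sumr mulr_suml; apply: eq_bigr => b /eqP bm.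
  have [->|zb] := eqVneq (z b w) 0; first by rewrite !(mul0r, mulr0).
  rewrite -bm phiK 1?eq_sym; last by apply/existsP; exists w.
  by rewrite mulrC; congr (_ * _); rewrite mulrC divfK // gt_eqF.
by rewrite sum_fibers sum_delta.
Qed.

Lemma direct_persuasion : persuasion_profile mu0 e (direct_msg iota z) (direct_act phi).
Proof.
split; [exact: direct_msg_strat|exact: direct_act_strat|].
apply/R_BRP; first exact: direct_act_strat.
move=> m a b; rewrite /direct_act; have [<- _|_] := eqVneq (phi m) a; last by rewrite ltxx.
have mv c : msg_value e.2 (direct_msg iota z) m c =
    \sum_(a' | iota a' == m) \sum_w z a' w * e.2 c w.
  rewrite exchange_big /=; apply: eq_bigr => w _.
  rewrite /direct_msg mulr_sumr mulr_suml; apply: eq_bigr => a' _.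
  by congr (_ * _); rewrite mulrC divfK // gt_eqF.
rewrite !mv; apply: ler_sum => a' /eqP am.
have [ua|/existsPn nu] := boolP (used z a'); last first.
  by rewrite !big1 // => w _; have := nu w; rewrite negbK => /eqP ->; rewrite mul0r.
rewrite -am phiK // -subr_ge0 -sumrB.
have [_ _ /(_ a' b)] := oz; congr (0 <= _); apply: eq_bigr => w _; ring.
Qed.

Lemma direct_payoff u : payoff mu0 u (direct_msg iota z) (direct_act phi) = value u z.
Proof.
rewrite payoff_outcome; apply: eq_bigr => a _; apply: eq_bigr => w _.
by rewrite direct_outcome.
Qed.

End Direct.

Hypothesis Om_gt0 : (0 < #|Om|)%N.
Hypothesis A_le_M : (#|A| <= #|M|)%N.

(** Messages that recommend no used action are decoded as the used action [a0]. Off-path messages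
    thus offer the Sender nothing beyond the used actions, as [strict_cheap_talk] requires. *)
Lemma exists_direct e z : outcome mu0 e z -> exists (iota : A -> M) (phi : M -> A),
  [/\ injective iota, forall a, used z a -> phi (iota a) = a & forall m, used z (phi m)].
Proof.
move=> [z0 zs _].
have [w0 _] : exists w : Om, true by case/card_gt0P: Om_gt0 => w _; exists w.
have [a0 ua0] : exists a, used z a.
  have [/existsP//|/existsPn no] := boolP [exists a, used z a].
  have := mu0_gt0 w0; rewrite -zs big1 ?ltxx // => a _.
  by have := no a => /existsPn/(_ w0); rewrite negbK => /eqP.
pose iota a : M := enum_val (widen_ord A_le_M (enum_rank a)).
have iotaI : injective iota.
  by move=> a b /enum_val_inj /(congr1 val) /= /val_inj /enum_rank_inj.
exists iota, (fun m => odflt a0 [pick a | (iota a == m) && used z a]); split=> //.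
  move=> a ua; case: pickP => [b /andP[/eqP/iotaI-> //]|/(_ a)].
  by rewrite eqxx ua.
by move=> m; case: pickP => [b /andP[]|].
Qed.

(** * Bounds on the three payoffs and the implications between the statements *)

Section Payoffs.
Variable e : env R A Om.
Hypothesis ce : in_cube e.

Lemma payoff_le1 sigma rho : persuasion_profile mu0 e sigma rho ->
  payoff mu0 e.1 sigma rho <= 1.
Proof.
move=> /outcome_of_outcome[z0 zs _]; rewrite payoff_outcome -mu0_sum.
under [leRHS]eq_bigr do rewrite -zs; rewrite [leRHS]exchange_big /=.
apply: ler_sum => a _; apply: ler_sum => w _.
by rewrite ler_piMr //; have [/andP[]] := ce a w.
Qed.

Lemma payoff_le_sup (Q : (Om -> M -> R) -> (M -> A -> R) -> Prop) sigma rho :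
  (forall s r, Q s r -> persuasion_profile mu0 e s r) -> Q sigma rho ->
  payoff mu0 e.1 sigma rho <=
    sup (fun v => exists s r, Q s r /\ v = payoff mu0 e.1 s r).
Proof.
move=> hQ q; apply: sup_upper_bound; last by exists sigma, rho.
split; first by exists (payoff mu0 e.1 sigma rho), sigma, rho.
by exists 1 => _ [s [r [/hQ q' ->]]]; apply: payoff_le1.
Qed.

Lemma le_persuasion_payoff sigma rho : persuasion_profile mu0 e sigma rho ->
  payoff mu0 e.1 sigma rho <= persuasion_payoff M mu0 e.
Proof. exact: payoff_le_sup. Qed.

Lemma le_cheap_talk_payoff sigma rho : cheap_talk_eq mu0 e sigma rho ->
  payoff mu0 e.1 sigma rho <= cheap_talk_payoff M mu0 e.
Proof. by apply: payoff_le_sup => s r []. Qed.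

(** Regroups the conjuncts into a single predicate on profiles, the form of [payoff_le_sup] and
    [sup_attained]. *)
Lemma partitional_persuasion_payoffE : partitional_persuasion_payoff M mu0 e =
  sup (fun v => exists sigma rho, (persuasion_profile mu0 e sigma rho /\
    partitional sigma) /\ v = payoff mu0 e.1 sigma rho).
Proof.
congr sup; apply/funext => v; apply/propext.
by split=> -[s [r h]]; exists s, r; intuition.
Qed.

Lemma le_partitional_payoff sigma rho : persuasion_profile mu0 e sigma rho ->
  partitional sigma -> payoff mu0 e.1 sigma rho <= partitional_persuasion_payoff M mu0 e.
Proof.
move=> h1 h2; rewrite partitional_persuasion_payoffE.
by apply: (@payoff_le_sup (fun s r => persuasion_profile mu0 e s r /\ partitional s)) => // s r [].
Qed.

Lemma value_le_persuasion z : outcome mu0 e z -> value e.1 z <= persuasion_payoff M mu0 e.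
Proof.
move=> oz; have [iota [phi [_ phiK _]]] := exists_direct oz.
rewrite -(direct_payoff phiK); apply: le_persuasion_payoff.
exact: direct_persuasion.
Qed.

Lemma optimal_profile_outcome sigma rho : optimal_persuasion mu0 e sigma rho ->
  optimal_outcome mu0 e (outcome_of sigma rho).
Proof.
move=> [pp opt]; split; first exact: outcome_of_outcome.
by move=> z /value_le_persuasion; rewrite -opt payoff_outcome.
Qed.

Lemma deterministic_le_partitional z : outcome mu0 e z ->
  (forall w, exists a, z a w = mu0 w) -> value e.1 z <= partitional_persuasion_payoff M mu0 e.
Proof.
move=> oz det; have [iota [phi [iotaI phiK _]]] := exists_direct oz.
rewrite -(direct_payoff phiK); apply: le_partitional_payoff.
  exact: direct_persuasion.
move=> w; have [a za] := det w; exists (iota a).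
rewrite /direct_msg (eq_bigl (pred1 a)); last by move=> b; rewrite /= (inj_eq iotaI).
by rewrite big_pred1_eq za divff // gt_eqF.
Qed.

(* Under strict obedience, shifting a little mass of state w from action a to another
   used action b keeps the outcome feasible. *)
Lemma strict_no_deviation z : optimal_outcome mu0 e z ->
  (forall a b, used z a -> a != b -> 0 < obedience e.2 z a b) ->
  forall w a b, z a w != 0 -> used z b -> e.1 b w <= e.1 a w.
Proof.
move=> oz strict w a b za ub.
have ua : used z a by apply/existsP; exists w.
pose d a' w' := (w == w')%:R * ((b == a')%:R - (a == a')%:R) : R.
have h t : \sum_(m : A) (t == m)%:R = 1 :> R.
  by rewrite -[RHS](@sum_delta R A t (fun=> 1)); apply: eq_bigr => m _; rewrite mulr1.
suff <- : value e.1 d <= 0 = (e.1 b w <= e.1 a w).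
  apply: (optimal_direction oz) => [w'|a' w' za'|a' b' ob].
  - by rewrite -mulr_sumr sumrB !h subrr mulr0.
  - rewrite /d; have [ww|_] := eqVneq w w'; last by rewrite mul0r.
    have [aa|_] := eqVneq a a'; first by rewrite aa ww za' eqxx in za.
    by rewrite mul1r subr0 ler0n.
  - have [<-|ab'] := eqVneq a' b'.
      by rewrite /obedience sumr_ge0 // => w' _; rewrite subrr mulr0.
    have nu : ~~ used z a'.
      by apply/negP => ua'; have := strict _ _ ua' ab'; rewrite ob ltxx.
    rewrite /obedience sumr_ge0 // => w' _; rewrite /d.
    have /negbTE-> : b != a' by apply: contraNneq nu => <-.
    have /negbTE-> : a != a' by apply: contraNneq nu => <-.
    by rewrite subrr mulr0 mul0r.
rewrite -[RHS]subr_le0; congr (_ <= 0); rewrite /value.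
rewrite -[e.1 b w](@sum_delta R A b (e.1^~ w)) -[e.1 a w](@sum_delta R A a (e.1^~ w)) -sumrB.
apply: eq_bigr => a' _; rewrite -mulrBl.
rewrite -[RHS](@sum_delta R Om w (fun w' => ((b == a')%:R - (a == a')%:R) * e.1 a' w')).
by apply: eq_bigr => w' _; rewrite /d mulrA.
Qed.

Lemma strict_cheap_talk z : optimal_outcome mu0 e z ->
  (forall a b, used z a -> a != b -> 0 < obedience e.2 z a b) ->
  value e.1 z <= cheap_talk_payoff M mu0 e.
Proof.
move=> oz strict; have nd := strict_no_deviation oz strict.
have [iota [phi [_ phiK phiU]]] := exists_direct oz.1.
have [hs hr br] := direct_persuasion oz.1 phiK.
rewrite -(direct_payoff phiK); apply: le_cheap_talk_payoff; split=> //.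
apply/(S_BRP _ _ hs) => w m m' /(direct_msg_gt0 phiK) [a [_ za pa]].
by rewrite /direct_act !sum_delta pa; apply: nd.
Qed.

Lemma receiver_argmaxP sigma m a : msg_strat sigma -> m \in Msupp sigma ->
  a \in receiver_argmax mu0 e sigma m <->
  (forall b, msg_value e.2 sigma m b <= msg_value e.2 sigma m a).
Proof.
move=> hs; rewrite inE => /existsP[w sw].
have D0 : 0 < \sum_w' mu0 w' * sigma w' m.
  have s0 w' : 0 <= mu0 w' * sigma w' m by rewrite mulr_ge0 ?(ltW (mu0_gt0 _)) //; case: (hs w').
  by rewrite (bigD1 w) //= ltr_wpDr ?sumr_ge0 // mulr_gt0.
have pe b : \sum_w' posterior mu0 sigma m w' * e.2 b w' =
    msg_value e.2 sigma m b / \sum_w' mu0 w' * sigma w' m.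
  by rewrite /msg_value mulr_suml; apply: eq_bigr => w' _; rewrite /posterior mulrAC.
rewrite inE; split=> [/forallP h b|h].
  by have := h b; rewrite !pe ler_pM2r // invr_gt0.
by apply/forallP => b; rewrite !pe ler_pM2r // invr_gt0.
Qed.

(** Obedience is a sum of nonnegative terms over messages. Some sent message leads to [a], and its
    term is positive because [b] cannot tie with [a] there. *)
Lemma unique_response_strict sigma rho : persuasion_profile mu0 e sigma rho ->
  (forall m, m \in Msupp sigma -> (#|receiver_argmax mu0 e sigma m| <= 1)%N) ->
  forall a b, used (outcome_of sigma rho) a -> a != b ->
    0 < obedience e.2 (outcome_of sigma rho) a b.
Proof.
move=> [hs hr /(R_BRP _ _ hr) br] uniq a b /existsP[w zaw] ab.
have r0 m a' : 0 <= rho m a' by case: (hr m).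
have s0 w' m : 0 <= sigma w' m by case: (hs w').
have [m sm rm] : exists2 m, 0 < sigma w m & 0 < rho m a.
  have [/existsP[m /andP[]]|/existsPn no] :=
    boolP [exists m, (0 < sigma w m) && (0 < rho m a)]; first by exists m.
  case/eqP: zaw; rewrite /outcome_of big1 // => m _; have := no m.
  rewrite negb_and -!leNgt => /orP[h|h].
    by rewrite (_ : sigma w m = 0) ?mulr0 ?mul0r //; apply/eqP; rewrite eq_le h s0.
  by rewrite (_ : rho m a = 0) ?mulr0 //; apply/eqP; rewrite eq_le h r0.
have mS : m \in Msupp sigma by rewrite inE; apply/existsP; exists w.
rewrite obedience_outcome_of (bigD1 m) //= ltr_wpDr //.
  apply: sumr_ge0 => m' _; have [->|ra] := eqVneq (rho m' a) 0; first by rewrite mul0r.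
  by rewrite mulr_ge0 // subr_ge0 br // lt_neqAle eq_sym ra r0.
rewrite pmulr_rgt0 // subr_gt0 lt_neqAle br // andbT.
apply/eqP => eab.
have aa : a \in receiver_argmax mu0 e sigma m by apply/receiver_argmaxP => // c; apply: br.
have bb : b \in receiver_argmax mu0 e sigma m.
  by apply/receiver_argmaxP => // c; rewrite eab; apply: br.
have := uniq _ mS; rewrite leqNgt => /negP; apply.
by apply/card_gt1P; exists a, b.
Qed.

Lemma unique_response_cheap_talk sigma rho : optimal_persuasion mu0 e sigma rho ->
  (forall m, m \in Msupp sigma -> (#|receiver_argmax mu0 e sigma m| <= 1)%N) ->
  persuasion_payoff M mu0 e <= cheap_talk_payoff M mu0 e.
Proof.
move=> opt uniq; have [pp <-] := opt; rewrite payoff_outcome.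
apply: strict_cheap_talk; first exact: optimal_profile_outcome.
exact: unique_response_strict.
Qed.

Hypothesis reg : regular mu0 e.

Lemma partitional_unique_response sigma m : msg_strat sigma -> partitional sigma ->
  m \in Msupp sigma -> (#|receiver_argmax mu0 e sigma m| <= 1)%N.
Proof.
move=> hs part mS; rewrite leqNgt; apply/negP => /card_gt1P[a [b [aa bb ab]]].
have [_ ties _] := reg.
have s01 w : sigma w m = (sigma w m == 1)%:R.
  have [->//|s1] := eqVneq (sigma w m) 1.
  have [m' sm'] := part w; have [s0 ss] := hs w.
  have mm' : m != m' by apply: contraNneq s1 => ->; apply/eqP.
  have : \sum_(k | k != m') sigma w k = 0.
    by move: ss; rewrite (bigD1 m') //= sm'; lra.
  by move=> /psumr_eq0P-> // k _.
(* [W] is the cell of states that send [m]. A tie after [m] is a Receiver tie at the prior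
   conditioned on [W], which regularity excludes. *)
pose W := finset.finset (fun w => sigma w m == 1).
have : \sum_(w in W) mu0 w * (e.2 a w - e.2 b w) = 0.
  have -> : \sum_(w in W) mu0 w * (e.2 a w - e.2 b w) =
      msg_value e.2 sigma m a - msg_value e.2 sigma m b.
    rewrite /msg_value -sumrB big_mkcond /=; apply: eq_bigr => w _.
    by rewrite inE [sigma w m in RHS]s01; case: eqP => _; rewrite ?mulr1n ?mulr0n; ring.
  have /(receiver_argmaxP _ hs mS)/(_ b) := aa.
  have /(receiver_argmaxP _ hs mS)/(_ a) := bb.
  lra.
apply/eqP; apply: ties => //; apply/finset.set0Pn.
move: mS; rewrite inE => /existsP[w]; rewrite s01; case: eqP => [s1 _|]; last by rewrite ltxx.
by exists w; rewrite inE s1.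
Qed.

(* Moving the mass of a to b and that of b to a both keep the profile obedient, and
   their average is the given optimum, so both are optimal with distinct outcomes. *)
Lemma optimal_no_mixing sigma rho m a b : optimal_persuasion mu0 e sigma rho ->
  m \in Msupp sigma -> 0 < rho m a -> 0 < rho m b -> a = b.
Proof.
move=> opt mS ra rb; have [[hs hr br] pay] := opt.
have brP := (R_BRP e sigma hr).1 br.
have shiftP a' b' : 0 < rho m a' -> 0 < rho m b' ->
    persuasion_profile mu0 e sigma (shift rho m a' b').
  move=> ra' rb'; have hr' := @shift_distr _ _ _ rho m a' b' hr.
  split=> //; apply/(R_BRP _ _ hr') => m' c c' rc; apply: brP; move: rc; rewrite /shift.
  have [<-|_] := eqVneq m m'; last by rewrite mul0r addr0.
  have [<-//|_] := eqVneq b' c; rewrite sub0r mul1r mulrN => h.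
  apply: lt_le_trans h _; rewrite gerBl mulr_ge0 ?ler0n //; exact: ltW.
have shift_payoff a' b' : payoff mu0 e.1 sigma (shift rho m a' b') =
   payoff mu0 e.1 sigma rho + rho m a' * (msg_value e.1 sigma m b' - msg_value e.1 sigma m a').
  by rewrite !payoff_msg shift_sum.
have le a' b' : 0 < rho m a' -> 0 < rho m b' ->
    msg_value e.1 sigma m b' <= msg_value e.1 sigma m a'.
  move=> ra' rb'; have := le_persuasion_payoff (shiftP _ _ ra' rb').
  by rewrite shift_payoff -pay gerDl pmulr_rle0 // subr_le0.
have opt' : optimal_persuasion mu0 e sigma (shift rho m a b).
  split; first exact: shiftP.
  rewrite shift_payoff -pay; have -> : msg_value e.1 sigma m b = msg_value e.1 sigma m a.
    by apply/eqP; rewrite eq_le !le.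
  by rewrite subrr mulr0 addr0.
have [_ _ uniq] := reg.
have [//|ab] := eqVneq a b.
move: mS; rewrite inE => /existsP[w sw].
(* In state [w], which sends [m], the shift removes from [a] the positive mass mu0(w) sigma(m|w)
   rho(a|m), so the two optimal outcomes differ. *)
have := uniq _ _ (optimal_profile_outcome opt) (optimal_profile_outcome opt') a w.
move=> /eqP; rewrite -subr_eq0 /outcome_of -sumrB (bigD1 m) //= big1 => [|m' mm'].
  rewrite addr0 /shift !eqxx [b == a]eq_sym (negbTE ab) -mulrBr mulf_eq0 gt_eqF ?mulr_gt0 //=.
  by move=> /eqP h; move: ra; rewrite (_ : rho m a = 0) ?ltxx //; move: h; rewrite /=; lra.
by rewrite /shift eq_sym (negbTE mm') mul0r addr0 subrr.
Qed.

Lemma optimal_cheap_talk_partitional sigma rho : cheap_talk_eq mu0 e sigma rho ->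
  payoff mu0 e.1 sigma rho = persuasion_payoff M mu0 e ->
  persuasion_payoff M mu0 e <= partitional_persuasion_payoff M mu0 e.
Proof.
move=> [hs hr /(S_BRP _ _ hs) sbr rbr] pay.
have opt : optimal_persuasion mu0 e sigma rho by split.
have [ties _ _] := reg.
have r0 m a' : 0 <= rho m a' by case: (hr m).
have s0 w' m : 0 <= sigma w' m by case: (hs w').
have pure m a w : 0 < sigma w m -> 0 < rho m a -> \sum_c rho m c * e.1 c w = e.1 a w.
  move=> sm ra; have mS : m \in Msupp sigma by rewrite inE; apply/existsP; exists w.
  have z c : c != a -> rho m c = 0.
    move=> ca; apply/eqP; rewrite eq_le r0 andbT leNgt; apply/negP => rc.
    by case/eqP: ca; apply: (optimal_no_mixing opt mS).
  have [_] := hr m; rewrite (bigD1 a) //= big1 ?addr0 => [ra1|c /z//].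
  by rewrite (bigD1 a) //= big1 ?addr0 ?ra1 ?mul1r // => c /z->; rewrite mul0r.
(* Both messages are sent in [w], so the Sender is indifferent between them there; without Sender
   ties their actions coincide. *)
have same w m m' a b : 0 < sigma w m -> 0 < sigma w m' -> 0 < rho m a -> 0 < rho m' b -> a = b.
  move=> sm sm' ra rb; apply/eqP/negPn/negP => /(ties _ _ w) /eqP; apply.
  have := sbr w m m' sm; have := sbr w m' m sm'.
  by rewrite (pure m a) // (pure m' b) // => h1 h2; apply/eqP; rewrite eq_le h1 h2.
have oz := optimal_profile_outcome opt.
rewrite -pay payoff_outcome; apply: deterministic_le_partitional; first by case: oz.
move=> w; have [m sm] := distr_gt0 (hs w); have [a ra] := distr_gt0 (hr m); exists a.
have [[_ <- _] _] := oz; rewrite [RHS](bigD1 a) //= big1 ?addr0 // => b ba.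
rewrite /outcome_of big1 // => m' _.
have [->|sm'] := eqVneq (sigma w m') 0; first by rewrite mulr0 mul0r.
have [->|rb] := eqVneq (rho m' b) 0; first by rewrite mulr0.
case/eqP: ba; apply: (same w m' m) => //.
  by rewrite lt_neqAle eq_sym sm' s0.
by rewrite lt_neqAle eq_sym rb r0.
Qed.

End Payoffs.
End Game.

(** * Compactness of the profile space and attainment of the suprema *)

Section Attainment.
Variables (R : realType) (A Om M : finType) (mu0 : Om -> R).
Implicit Types (e : env R A Om).
Local Open Scope classical_set_scope.

(** Both strategies are flattened into one family of reals, so that Tychonoff's theorem gives
    compactness. *)
Definition profile := prod_topology (fun _ : (Om * M) + (M * A) => R).
Definition msg_of (x : profile) : Om -> M -> R := fun w m => x (inl (w, m)).
Definition act_of (x : profile) : M -> A -> R := fun m a => x (inr (m, a)).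
Definition mk_profile sigma rho : profile := fun k =>
  match k with inl p => sigma p.1 p.2 | inr p => rho p.1 p.2 end.

Lemma coord_profile_continuous k : continuous (fun x : profile => x k : R).
Proof. by move=> x; apply: (@proj_continuous _ (fun=> R)). Qed.

Lemma continuous_mul (T : topologicalType) (f g : T -> R) :
  continuous f -> continuous g -> continuous (fun x => f x * g x).
Proof. by move=> cf cg x; exact: (cvgM (cf x) (cg x)). Qed.

Lemma continuous_sub (T : topologicalType) (f g : T -> R) :
  continuous f -> continuous g -> continuous (fun x => f x - g x).
Proof. by move=> cf cg x; exact: (cvgB (cf x) (cg x)). Qed.

Lemma continuous_sum (T : topologicalType) (I : Type) (s : seq I) (F : I -> T -> R) :
  (forall i, continuous (F i)) -> continuous (fun x => \sum_(i <- s) F i x).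
Proof.
by move=> cF; apply: continuous_big => //; exact: add_continuous.
Qed.

Lemma continuous_prod (T : topologicalType) (I : Type) (s : seq I) (F : I -> T -> R) :
  (forall i, continuous (F i)) -> continuous (fun x => \prod_(i <- s) F i x).
Proof.
by move=> cF; apply: continuous_big => //; exact: mul_continuous.
Qed.

Lemma payoff_continuous u (s : profile -> Om -> M -> R) (r : profile -> M -> A -> R) :
  (forall w m, continuous (fun x => s x w m)) -> (forall m a, continuous (fun x => r x m a)) ->
  continuous (fun x => payoff mu0 u (s x) (r x)).
Proof.
move=> cs cr; apply: continuous_sum => w; apply: continuous_sum => m.
apply: continuous_sum => a.
apply: (@continuous_mul _ (fun x => mu0 w * s x w m * r x m a)); last exact: cst_continuous.
apply: (@continuous_mul _ (fun x => mu0 w * s x w m)); last exact: cr.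
by apply: (@continuous_mul _ (fun=> mu0 w)); [exact: cst_continuous|exact: cs].
Qed.

Lemma msg_of_continuous w m : continuous (fun x => msg_of x w m).
Proof. exact: coord_profile_continuous. Qed.

Lemma act_of_continuous m a : continuous (fun x => act_of x m a).
Proof. exact: coord_profile_continuous. Qed.

(** The index may range over an infinite type: for best responses [i] is a deviation, and [D]
    selects those that are strategies. *)
Lemma closed_forall_le (T : topologicalType) (I : Type) (D : I -> Prop) (f g : I -> T -> R) :
  (forall i, continuous (f i)) -> (forall i, continuous (g i)) ->
  closed [set x | forall i, D i -> f i x <= g i x].
Proof.
move=> cf cg.
have -> : [set x | forall i, D i -> f i x <= g i x] =
    \bigcap_(i in D) ((fun x => f i x - g i x) @^-1` [set y | y <= 0]).
  by apply/seteqP; split=> x h i Di; have /= := h i Di; rewrite subr_le0.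
apply: closed_bigI => i Di; have /continuous_closedP : continuous (fun x => f i x - g i x).
  exact: continuous_sub.
by apply; exact: closed_le.
Qed.

Lemma closed_forall_eq (T : topologicalType) (I : Type) (f : I -> T -> R) (c : R) :
  (forall i, continuous (f i)) -> closed [set x | forall i, f i x = c].
Proof.
move=> cf.
have -> : [set x | forall i, f i x = c] = \bigcap_(i in setT) (f i @^-1` [set y | y = c]).
  by apply/seteqP; split=> x h i; have /= := h i; auto.
apply: closed_bigI => i _; have /continuous_closedP := cf i.
by apply; exact: closed_eq.
Qed.

Lemma closed_msg_strat : closed [set x | msg_strat (msg_of x)].
Proof.
have -> : [set x | msg_strat (msg_of x)] =
    [set x | forall k : Om * M, True -> 0 <= msg_of x k.1 k.2] `&`
    [set x | forall w, \sum_m msg_of x w m = 1].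
  apply/seteqP; split=> x /= => [h|[h1 h2] w]; last first.
    by split=> // m; exact: (h1 (w, m)).
  by split=> [[w m] _|w] /=; case: (h w).
apply: closedI.
  by apply: closed_forall_le => k; [exact: cst_continuous|exact: msg_of_continuous].
by apply: closed_forall_eq => w; apply: continuous_sum => m; exact: msg_of_continuous.
Qed.

Lemma closed_act_strat : closed [set x | act_strat (act_of x)].
Proof.
have -> : [set x | act_strat (act_of x)] =
    [set x | forall k : M * A, True -> 0 <= act_of x k.1 k.2] `&`
    [set x | forall m, \sum_a act_of x m a = 1].
  apply/seteqP; split=> x /= => [h|[h1 h2] w]; last first.
    by split=> // m; exact: (h1 (w, m)).
  by split=> [[w m] _|w] /=; case: (h w).
apply: closedI.
  by apply: closed_forall_le => k; [exact: cst_continuous|exact: act_of_continuous].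
by apply: closed_forall_eq => w; apply: continuous_sum => m; exact: act_of_continuous.
Qed.

Lemma closed_S_BR e : closed [set x | S_BR mu0 e (msg_of x) (act_of x)].
Proof.
apply: (@closed_forall_le _ _ (@msg_strat R Om M)) => s.
  apply: payoff_continuous => [w m|m a]; [exact: cst_continuous|exact: act_of_continuous].
by apply: payoff_continuous => *; [exact: msg_of_continuous|exact: act_of_continuous].
Qed.

Lemma closed_R_BR e : closed [set x | R_BR mu0 e (msg_of x) (act_of x)].
Proof.
apply: (@closed_forall_le _ _ (@act_strat R A M)) => r.
  apply: payoff_continuous => [w m|m a]; [exact: msg_of_continuous|exact: cst_continuous].
by apply: payoff_continuous => *; [exact: msg_of_continuous|exact: act_of_continuous].
Qed.

(** The existential over messages becomes the vanishing of a finite product, a continuous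
    equation. *)
Lemma closed_partitional : closed [set x | partitional (msg_of x)].
Proof.
have -> : [set x | partitional (msg_of x)] =
    [set x | forall w, \prod_m (msg_of x w m - 1) = 0].
  apply/seteqP; split=> x /= h w.
    by have [m hm] := h w; rewrite (bigD1 m) //= hm subrr mul0r.
  by have /eqP/prodf_eq0[m _] := h w; rewrite subr_eq0 => /eqP; exists m.
apply: closed_forall_eq => w; apply: continuous_prod => m.
by apply: continuous_sub; [exact: msg_of_continuous|exact: cst_continuous].
Qed.

Lemma closed_persuasion e : closed [set x | persuasion_profile mu0 e (msg_of x) (act_of x)].
Proof.
have -> : [set x | persuasion_profile mu0 e (msg_of x) (act_of x)] =
    [set x | msg_strat (msg_of x)] `&` ([set x | act_strat (act_of x)] `&`
    [set x | R_BR mu0 e (msg_of x) (act_of x)]).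
  by apply/seteqP; split=> x; [case=> ? ? ?|case=> ? [? ?]].
apply: closedI; first exact: closed_msg_strat.
by apply: closedI; [exact: closed_act_strat|exact: closed_R_BR].
Qed.

Lemma closed_cheap_talk e : closed [set x | cheap_talk_eq mu0 e (msg_of x) (act_of x)].
Proof.
have -> : [set x | cheap_talk_eq mu0 e (msg_of x) (act_of x)] =
    [set x | persuasion_profile mu0 e (msg_of x) (act_of x)] `&`
    [set x | S_BR mu0 e (msg_of x) (act_of x)].
  by apply/seteqP; split=> x; [case=> ? ? ? ?|case=> -[? ? ?] ?].
by apply: closedI; [exact: closed_persuasion|exact: closed_S_BR].
Qed.

Lemma distr_in01 (T : finType) (p : T -> R) t : is_distr p -> 0 <= p t <= 1.
Proof.
move=> [p0 p1]; rewrite p0 -p1 (bigD1 t) //= lerDl.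
exact: sumr_ge0.
Qed.

(** A closed set of strategy profiles is compact, being inside a cube, and the payoff is continuous;
    so the suprema defining the payoffs are maxima. *)
Lemma sup_attained e (Q : (Om -> M -> R) -> (M -> A -> R) -> Prop) :
  (exists s r, Q s r) -> (forall s r, Q s r -> msg_strat s /\ act_strat r) ->
  closed [set x | Q (msg_of x) (act_of x)] ->
  exists s r, Q s r /\
    payoff mu0 e.1 s r = sup (fun v => exists s r, Q s r /\ v = payoff mu0 e.1 s r).
Proof.
move=> [s0 [r0 q0]] hQ cQ.
pose X : set profile := [set x | Q (msg_of x) (act_of x)].
have cX : compact X.
  apply: (@subclosed_compact _ _ [set x : profile | forall k, `[0, 1] (x k)]) => //.
    apply: (@tychonoff _ (fun=> R) (fun=> `[0, 1])) => k.
    exact: segment_compact.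
  move=> x /hQ[hs hr] [[w m]|[m a]] /=; rewrite in_itv /=; first exact: (distr_in01 m (hs w)).
  exact: (distr_in01 a (hr m)).
have [|||x xX xmax] := @compact_EVT_max _ R
    (fun x : profile => payoff mu0 e.1 (msg_of x) (act_of x)) X.
- by exists (mk_profile s0 r0).
- exact: cX.
- apply: continuous_subspaceT.
  by apply: payoff_continuous => *; [exact: msg_of_continuous|exact: act_of_continuous].
exists (msg_of x), (act_of x); have Qx : Q (msg_of x) (act_of x) by rewrite inE in xX.
split=> //; apply/eqP; rewrite eq_le; apply/andP; split.
  apply: sup_upper_bound; last by exists (msg_of x), (act_of x).
  split; first by exists (payoff mu0 e.1 s0 r0), s0, r0.
  exists (payoff mu0 e.1 (msg_of x) (act_of x)) => _ [s [r [q ->]]].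
  by apply: (xmax (mk_profile s r)); rewrite inE.
apply: ge_sup; first by exists (payoff mu0 e.1 s0 r0), s0, r0.
move=> _ [s [r [q ->]]].
by apply: (xmax (mk_profile s r)); rewrite inE.
Qed.

Hypothesis mu0_gt0 : forall w, 0 < mu0 w.
Hypothesis A_gt0 : (0 < #|A|)%N.
Hypothesis M_gt0 : (0 < #|M|)%N.

(** The babbling equilibrium: the Sender always sends [m0] and every message is answered by a best
    action [b] at the prior. It provides the nonemptiness for both uses of [sup_attained]. *)
Lemma exists_babbling e : exists sigma rho,
  cheap_talk_eq mu0 e sigma rho /\ @partitional R Om M sigma.
Proof.
have /card_gt0P[a0 _] := A_gt0; have /card_gt0P[m0 _] := M_gt0.
pose sigma (w : Om) (m : M) : R := (m0 == m)%:R.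
pose V a := msg_value mu0 e.2 sigma m0 a.
pose b := [arg max_(a > a0) V a]%O.
have Vb a : V a <= V b by rewrite /b; case: arg_maxP => // c _ /(_ a); apply.
have delta_distr (T : finType) (t : T) : is_distr (fun t' => (t == t')%:R : R).
  split=> [t'|]; first by rewrite ler0n.
  rewrite -[RHS](@sum_delta R T t (fun=> 1)).
  by apply: eq_bigr => ? _; rewrite mulr1.
pose rho (m : M) (a : A) : R := (b == a)%:R.
have hs : msg_strat sigma by move=> w; apply: delta_distr.
have hr : act_strat rho by move=> m; apply: delta_distr.
exists sigma, rho; split; last by move=> w; exists m0; rewrite /sigma eqxx.
split=> //.
  by apply/S_BRP.
apply/R_BRP => // m a c; rewrite /rho; have [<- _|_] := eqVneq b a; last by rewrite ltxx.
have [<-//|mm] := eqVneq m0 m.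
by rewrite /msg_value !big1 // => w _; rewrite /sigma (negbTE mm) mulr0 mul0r.
Qed.

End Attainment.

(** * The equivalence outside the null set of non-regular environments *)

Theorem mainTheorem2 (R : realType) (A Om M : finType) (mu0 : Om -> R)
  (hA : (0 < #|A|)%N) (hOm : (0 < #|Om|)%N)
  (hmu0pos : forall w, 0 < mu0 w) (hmu0sum : \sum_(w : Om) mu0 w = 1)
  (hM : (maxn #|Om| #|A| < #|M|)%N) :
  exists N : env R A Om -> Prop,
    lebesgue_null N /\
    forall e : env R A Om, in_cube e -> ~ N e ->
      (commitment_valuable M mu0 e <-> values_randomization M mu0 e) /\
      (values_randomization M mu0 e <-> indifference_at_optimum M mu0 e).
Proof.
have [[a0 _] [w0 _]] := (card_gt0P hA, card_gt0P hOm).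
have AM : (#|A| <= #|M|)%N by rewrite ltnW // (leq_ltn_trans _ hM) // leq_maxr.
have M0 : (0 < #|M|)%N by apply: leq_trans hA AM.
exists (fun e => in_cube e /\ ~ regular mu0 e); split; first exact: null_not_regular.
move=> e ce nN.
have reg : regular mu0 e by apply: contrapT => nreg; apply: nN.
have [sb [rb [ctb ptb]]] := @exists_babbling R A Om M mu0 hmu0pos hA M0 e.
have i_iii : commitment_valuable M mu0 e -> indifference_at_optimum M mu0 e.
  move=> cv sigma rho opt; apply: contrapT => no.
  move: cv; rewrite /commitment_valuable ltNge => /negP; apply.
  apply: (unique_response_cheap_talk hmu0pos hmu0sum hOm AM ce opt) => m mS.
  by rewrite leqNgt; apply/negP => h; apply: no; exists m.
have iii_ii : indifference_at_optimum M mu0 e -> values_randomization M mu0 e.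
  move=> ind; rewrite /values_randomization ltNge; apply/negP => le.
  (* If randomization had no value, a best partitional profile would be optimal among all persuasion
     profiles, so [ind] would apply to it. *)
  have [|||s [r [[pp part] pay]]] := @sup_attained R A Om M mu0 e
      (fun s r => persuasion_profile mu0 e s r /\ partitional s).
  - by exists sb, rb; case: ctb.
  - by move=> s r [[]].
  - by apply: closedI; [exact: closed_persuasion|exact: closed_partitional].
  rewrite -partitional_persuasion_payoffE in pay.
  have [hs _ _] := pp.
  have opt : optimal_persuasion mu0 e s r.
    split=> //; apply/eqP; rewrite eq_le le_persuasion_payoff //=.
    by rewrite pay.
  have [m mS] := ind _ _ opt; rewrite ltnNge => /negP; apply.
  exact: (partitional_unique_response hmu0pos reg).
have ii_i : values_randomization M mu0 e -> commitment_valuable M mu0 e.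
  move=> vr; rewrite /commitment_valuable ltNge; apply/negP => le.
  move: vr; rewrite /values_randomization ltNge => /negP; apply.
  (* If commitment had no value, a best cheap-talk equilibrium would attain the persuasion
     payoff. *)
  have [|||s [r [ct pay]]] := @sup_attained R A Om M mu0 e (cheap_talk_eq mu0 e).
  - by exists sb, rb.
  - by move=> s r [].
  - exact: closed_cheap_talk.
  apply: (optimal_cheap_talk_partitional hmu0pos hmu0sum hOm AM ce reg ct).
  apply/eqP; rewrite eq_le; apply/andP; split; last by rewrite pay.
  by apply: le_persuasion_payoff => //; case: ct.
split; split=> h.
- exact/iii_ii/i_iii.
- exact: ii_i.
- exact/i_iii/ii_i.
- exact: iii_ii.
Qed.
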